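(* Let $X$ and $X'$ be tropical curves without bridges such that the polyhedral complexes $J^{qs}(X)$ and $J^{qs}(X')$ are isomorphic. Then there is a bijection between the biconnected components of $X$ and those of $X'$ such that corresponding components are isomorphic tropical curves.
   Context: A metric graph is a pair $(\Gamma,\ell)$ with $\Gamma$ a finite connected graph (loops and multiple edges allowed) and $\ell\colon E(\Gamma)\to\mathbb R_{>0}$; the associated tropical curve is the metric space obtained by gluing segments $[0,\ell(e)]$, $e\in E(\Gamma)$, at their endpoints according to $\Gamma$. The canonical model $(\Gamma_X,\ell_X)$ of a tropical curve $X$ is the unique model with no vertex of valence 2 (or the graph with one vertex and one loop). Bridges of $X$ are bridges of $\Gamma_X$ (edges whose removal disconnects). A graph is biconnected if, for every subdivision of it, removing any vertex does not disconnect it; a biconnected component of $X$ is the tropical curve given by a maximal biconnected subgraph $\Gamma'$ of $\Gamma_X$ with $\ell$ restricted to $\Gamma'$. For $\mathcal E\subset E(\Gamma)$, $\Gamma^{\mathcal E}$ is obtained by inserting a vertex $v_e$ in each $e\in\mathcal E$. A pseudo-divisor is $(\mathcal E,D)$ with $D\colon V(\Gamma^{\mathcal E})\to\mathbb Z$, $D(v_e)=1$ for $e\in\mathcal E$; $(\mathcal E,D)\ge(\mathcal E',D')$ iff $\mathcal E'\subset\mathcal E$ and there is $\varphi\colon\mathcal E\setminus\mathcal E'\to V(\Gamma)$, $\varphi(e)$ an end-vertex of $e$, with $D'(v)=D(v)+|\varphi^{-1}(v)|$ for $v\in V(\Gamma)$. With the (pure) canonical polarization $\mu(v)=-1+\mathrm{val}(v)/2$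 (loops counted twice; $\mu=0$ on exceptional vertices), $(\mathcal E,D)$ of degree $g-1$ ($g=b_1(\Gamma)$) is $v_0$-quasistable if $D(V)-\mu(V)+\delta_V/2\ge0$ for all nonempty $V\subset V(\Gamma^{\mathcal E})$, strictly if $v_0\notin V$ ($\delta_V$ = number of edges of $\Gamma^{\mathcal E}$ between $V$ and its complement). $\mathbf{QD}_{v_0}(\Gamma)$ is the poset of these. $J^{qs}(X)=J^{qs}_{v_0}(X)$ is the polyhedral complex obtained as the colimit of the cells $\mathcal P_X(\mathcal E,D)=\prod_{e\in\mathcal E}[0,\ell_X(e)]$ over $(\mathcal E,D)\in\mathbf{QD}_{v_0}(\Gamma_X)$, where for each relation $(\mathcal E,D)\ge(\mathcal E',D')$ the cell $\mathcal P_X(\mathcal E',D')$ is identified with the face of $\mathcal P_X(\mathcal E,D)$ obtained by fixing each coordinate $e\in\mathcal E\setminus\mathcal E'$ at the endpoint of $[0,\ell(e)]$ corresponding to the end-vertex to which $v_e$ is specialized; it is homeomorphic to the tropical Jacobian $J(X)$ and independent of $v_0$ up to isomorphism. An isomorphism of these polyhedral complexes is a homeomorphism mapping each cell onto a cell by an isometric isomorphism of polytopes, compatibly with the face structure. *)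

(* Defs.v *)
From HB Require Import structures.
From mathcomp Require Import all_boot all_order all_algebra.
Set Implicit Arguments.
Unset Strict Implicit.
Unset Printing Implicit Defensive.
Import Order.TTheory GRing.Theory Num.Theory.
Local Open Scope ring_scope.

(** * Graphs (loops and multiple edges allowed) *)

(* The orientation [src], [tgt] is auxiliary: it only names the two half-edges
   of an edge, i.e. the two endpoints 0 and l(e) of the segment [0, l(e)]. *)
Record mgraph := MGraph {
  vert : finType;
  edge : finType;
  src : edge -> vert;
  tgt : edge -> vert }.
Arguments src {_} _.
Arguments tgt {_} _.

Section Graph.
Variable G : mgraph.
Implicit Types (VS : {set vert G}) (ES : {set edge G}).

Definition edge_end (e : edge G) (b : bool) : vert G := if b then tgt e else src e.

(* Loops count twice. *)
Definition valence (v : vert G) : nat :=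
  (#|[set e : edge G | src e == v]| + #|[set e : edge G | tgt e == v]|)%N.

Definition adjacent VS ES : rel (vert G) := fun u v =>
  [&& u \in VS, v \in VS &
    [exists e in ES, [|| (src e == u) && (tgt e == v)
                       | (src e == v) && (tgt e == u)]]].

(* Any two vertices of [VS] are joined by a path in the graph with vertices [VS]
   and with the edges of [ES] whose end-vertices are in [VS]; this holds if [VS]
   is empty. *)
Definition connected_on VS ES : bool :=
  [forall u in VS, forall v in VS, connect (adjacent VS ES) u v].

Definition graph_connected : bool := (0 < #|vert G|)%N && connected_on setT setT.

Definition bridge (e : edge G) : bool := ~~ connected_on setT (setT :\ e).

(* b_1 of a connected graph *)
Definition genus : int := #|edge G|%:Z - #|vert G|%:Z + 1.

(* the number of edges between W and its complement *)
Definition cut_size (W : {set vert G}) : nat :=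
  #|[set e : edge G | (src e \in W) != (tgt e \in W)]|.

(* [n e] new vertices (e,0), ..., (e,n e - 1) are inserted in the edge e, in this
   order from [src e] to [tgt e]; e becomes the n e + 1 edges (e,0), ..., (e,n e),
   where (e,i) ends at the new vertex (e,i) if i < n e. *)
Section Subdivision.
Variable n : edge G -> nat.

Definition sub_vert : finType := (vert G + {e : edge G & 'I_(n e)})%type.
Definition sub_edge : finType := {e : edge G & 'I_(n e).+1}.

(* the k-th point of the path replacing e, from [src e] (k = 0) to [tgt e] *)
Definition sub_point (e : edge G) (k : nat) : sub_vert :=
  if k is k'.+1 then
    if (insub k' : option 'I_(n e)) is Some i then inr (Tagged (fun e => 'I_(n e)) i)
    else inl (tgt e)
  else inl (src e).

Definition subdivision : mgraph :=
  @MGraph sub_vert sub_edge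
    (fun a => sub_point (tag a) (tagged a))
    (fun a => sub_point (tag a) (tagged a).+1).
End Subdivision.

Record subgraph := Subgraph {
  sg_vert : {set vert G};
  sg_edge : {set edge G};
  sg_closed : [forall e in sg_edge, (src e \in sg_vert) && (tgt e \in sg_vert)] }.

Definition sg_le (S T : subgraph) : bool :=
  (sg_vert S \subset sg_vert T) && (sg_edge S \subset sg_edge T).

Section GraphOfSubgraph.
Variable S : subgraph.

Lemma sg_srcP (e : {e : edge G | e \in sg_edge S}) : src (val e) \in sg_vert S.
Proof. by have /forall_inP/(_ _ (valP e))/andP[] := sg_closed S. Qed.

Lemma sg_tgtP (e : {e : edge G | e \in sg_edge S}) : tgt (val e) \in sg_vert S.
Proof. by have /forall_inP/(_ _ (valP e))/andP[] := sg_closed S. Qed.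

Definition graph_of : mgraph :=
  @MGraph {v : vert G | v \in sg_vert S} {e : edge G | e \in sg_edge S}
    (fun e => Sub (src (val e)) (sg_srcP e))
    (fun e => Sub (tgt (val e)) (sg_tgtP e)).
End GraphOfSubgraph.

End Graph.
Arguments sub_vert {_} _.
Arguments sub_edge {_} _.

Definition no_bridges (G : mgraph) : Prop := forall e : edge G, ~~ bridge e.

Definition biconnected (G : mgraph) : Prop :=
  graph_connected G /\
  forall (n : edge G -> nat) (v : vert (subdivision n)),
    connected_on [set~ v] [set: edge (subdivision n)].

Record bicomponent (G : mgraph) := Bicomponent {
  bc_sub :> subgraph G;
  bc_biconnected : biconnected (graph_of bc_sub);
  bc_maximal : forall T : subgraph G,
    biconnected (graph_of T) -> sg_le bc_sub T -> sg_le T bc_sub }.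

(** * Quasistable pseudo-divisors *)

Section PseudoDivisors.
Variable G : mgraph.

(* the graph with one vertex inserted in each edge of ES *)
Definition insert_verts (ES : {set edge G}) : mgraph :=
  subdivision (fun e => nat_of_bool (e \in ES)).

Definition pseudo_divisor_data : Type :=
  {ES : {set edge G} & {ffun vert (insert_verts ES) -> int}}.

Record pseudo_divisor := PseudoDivisor {
  pd_data : pseudo_divisor_data;
  _ : [forall x, tagged pd_data (inr x) == 1] }.
HB.instance Definition _ := [isSub for pd_data].
HB.instance Definition _ := [Choice of pseudo_divisor by <:].

Definition pd_set (p : pseudo_divisor) : {set edge G} := tag (pd_data p).
Definition pd_div (p : pseudo_divisor) :
  {ffun vert (insert_verts (pd_set p)) -> int} := tagged (pd_data p).

Definition pd_edge (p : pseudo_divisor) : finType := {e : edge G | e \in pd_set p}.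

Definition at_vert (p : pseudo_divisor) (v : vert G) : int := pd_div p (inl v).

Definition specializes (phi : edge G -> vert G) (p q : pseudo_divisor) : Prop :=
  [/\ pd_set q \subset pd_set p,
      forall e, e \in pd_set p :\: pd_set q -> phi e = src e \/ phi e = tgt e
    & forall v, at_vert q v =
        at_vert p v + #|[set e in pd_set p :\: pd_set q | phi e == v]|%:Z].

Definition pd_ge (p q : pseudo_divisor) : Prop := exists phi, specializes phi p q.

Definition polarization (ES : {set edge G}) (x : vert (insert_verts ES)) : rat :=
  match x with
  | inl v => -1 + (valence v)%:R / 2
  | inr _ => 0
  end.

Definition stability (p : pseudo_divisor) (W : {set vert (insert_verts (pd_set p))}) :
  rat :=
  \sum_(x in W) (pd_div p x)%:~R - \sum_(x in W) polarization x
  + (cut_size W)%:R / 2.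

Definition quasistable (v0 : vert G) (p : pseudo_divisor) : bool :=
  (\sum_x pd_div p x == genus G - 1) &&
  [forall W : {set vert (insert_verts (pd_set p))}, (W != set0) ==>
    (0 <= stability W) && ((inl v0 \notin W) ==> (0 < stability W))].

Record QD (v0 : vert G) := QDiv {
  qd :> pseudo_divisor;
  _ : quasistable v0 qd }.
HB.instance Definition _ (v0 : vert G) := [isSub for @qd v0].
HB.instance Definition _ (v0 : vert G) := [Choice of QD v0 by <:].

End PseudoDivisors.

(* Imported only here: [set0], [setT] and [set: _] denote finite sets above. *)
From Stdlib Require Import Relations.
From mathcomp Require Import all_classical all_reals all_analysis.
Import numFieldNormedType.Exports.
Local Open Scope ring_scope.

(** * Metric graphs and tropical curves *)

Record metric_graph (R : realType) := MetricGraph {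
  mg_graph :> mgraph;
  mg_connected : graph_connected mg_graph;
  len : edge mg_graph -> R;
  len_gt0 : forall e, 0 < len e }.
Arguments len {_ _} _.

Section TropicalCurve.
Variables (R : realType) (X : metric_graph R).

(* The quotient of the disjoint union of the vertices and of the segments
   [0, l(e)], each of whose ends is identified with an end-vertex of e: a point
   is a vertex or is in the interior of exactly one segment. *)
Inductive curve : Type :=
| Vertex of vert X
| Inner (e : edge X) (t : R) of 0 < t < len e.

(* x is the image of the point t of the closed segment [0, l(e)] *)
Definition at_coord (e : edge X) (t : R) (x : curve) : Prop :=
  match x with
  | Vertex v => (t = 0 /\ v = src e) \/ (t = len e /\ v = tgt e)
  | Inner f s _ => f = e /\ s = t
  end.

(* a path from x to y of length L: a chain of moves, each within one segment *)
Inductive walk : curve -> curve -> R -> Prop :=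
| walk_nil x : walk x x 0
| walk_cons x y z e s t L :
    at_coord e s x -> at_coord e t y -> walk y z L -> walk x z (`|s - t| + L).

Definition curve_dist (x y : curve) : R := inf [set L | walk x y L]%classic.

End TropicalCurve.

Definition curve_isomorphic (R : realType) (X Y : metric_graph R) : Prop :=
  exists f : curve X -> curve Y,
    bijective f /\ forall x y, curve_dist (f x) (f y) = curve_dist x y.

Definition canonical_model (R : realType) (G X : metric_graph R) : Prop :=
  ((forall v : vert G, valence v <> 2%N) \/ (#|vert G| = 1 /\ #|edge G| = 1)%N) /\
  curve_isomorphic G X.

Section ComponentCurve.
Variables (R : realType) (X : metric_graph R) (C : bicomponent X).

Definition component_curve : metric_graph R :=
  @MetricGraph R (graph_of C) (proj1 (bc_biconnected C))
    (fun e => len (val e)) (fun e => len_gt0 (val e)).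
End ComponentCurve.

(** * The polyhedral complex J^qs *)

Section Jqs.
Variables (R : realType) (X : metric_graph R) (v0 : vert X).

(* the box inside R^E, E the set of edges of p, with the product topology *)
Definition box (p : QD v0) : set (prod_topology (fun _ : pd_edge p => R)) :=
  [set x | forall e : pd_edge p, 0 <= x e <= len (val e)]%classic.
Arguments box : clear implicits.

Definition cell (p : QD v0) : Type := set_type (box p).
HB.instance Definition _ (p : QD v0) := Topological.on (cell p).

Definition cell_coord (p : QD v0) (x : cell p) (e : pd_edge p) : R :=
  set_val x e.

Definition cells : Type := {p : QD v0 & cell p}.
HB.instance Definition _ := Topological.on cells.

Definition cell_point (p : QD v0) (x : cell p) : cells := existT _ p x.

(* y is identified with x if x is on the face of its cell given by a choice [b] of
   half-edges such that p specializes to q along the end-vertices of these. A loop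
   has one end-vertex but two half-edges, and both faces are glued. *)
Definition glued (a c : cells) : Prop :=
  let: existT p x := a in
  let: existT q y := c in
  exists b : edge X -> bool,
    [/\ specializes (fun e => edge_end e (b e)) p q,
        forall (e : pd_edge p) (f : pd_edge q), val e = val f ->
          cell_coord x e = cell_coord y f
      & forall e : pd_edge p, val e \notin pd_set q ->
          cell_coord x e = if b (val e) then len (val e) else 0].

Definition identified : rel cells := fun a c =>
  `[< clos_refl_sym_trans cells glued a c >].

Lemma identified_equiv : equiv_class_of identified.
Proof.
split.
- by move=> a; apply/asboolP; exact: rst_refl.
- by move=> a c; apply/asboolP/asboolP => ?; exact: rst_sym.
- move=> c a d /asboolP ac /asboolP cd; apply/asboolP; exact: rst_trans ac cd.
Qed.

Canonical identified_equivRel := EquivRelPack identified_equiv.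

Definition Jqs : Type := quotient_topology {eq_quot identified}%qT.
HB.instance Definition _ := Topological.on Jqs.

Definition cell_map (p : QD v0) (x : cell p) : Jqs :=
  \pi_({eq_quot identified})%qT (cell_point x).

End Jqs.
Arguments box {_ _ _} _ _.
Arguments cell {_ _ _} _.

Section PolytopeIso.
Variables (R : realType) (X X' : metric_graph R) (v0 : vert X) (v0' : vert X').
Variables (p : QD v0) (p' : QD v0').

(* an affine bijection that preserves the Euclidean distance *)
Definition polytope_isometry (f : cell p -> cell p') : Prop :=
  [/\ bijective f,
      forall (t : R) (x y z : cell p), 0 <= t <= 1 ->
        (forall e, cell_coord z e = (1 - t) * cell_coord x e + t * cell_coord y e) ->
        forall e, cell_coord (f z) e = (1 - t) * cell_coord (f x) e + t * cell_coord (f y) e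
    & forall x y : cell p,
        \sum_e (cell_coord (f x) e - cell_coord (f y) e) ^+ 2 =
        \sum_e (cell_coord x e - cell_coord y e) ^+ 2].
End PolytopeIso.

(* The cells of Jqs are the images of the maps [cell_map p], and [sigma] is the
   induced bijection between cells; the cell q is a face of p iff [pd_ge p q]. *)
Definition Jqs_isomorphic (R : realType) (X X' : metric_graph R)
    (v0 : vert X) (v0' : vert X') : Prop :=
  exists (F : Jqs v0 -> Jqs v0') (F' : Jqs v0' -> Jqs v0)
         (sigma : QD v0 -> QD v0'),
    [/\ [/\ continuous F, continuous F', cancel F F' & cancel F' F],
        bijective sigma,
        forall p q : QD v0, pd_ge p q <-> pd_ge (sigma p) (sigma q)
      & forall p : QD v0, exists2 f : cell p -> cell (sigma p),
          polytope_isometry f &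
          forall x, F (cell_map x) = cell_map (f x)].

(* Main.v *)
Require Import Defs.
From mathcomp Require Import all_boot all_order all_algebra lra zify.
Set Implicit Arguments.
Unset Strict Implicit.
Unset Printing Implicit Defensive.
Import Order.TTheory GRing.Theory Num.Theory.

(* A v0-quasistable pseudo-divisor (E, D) is encoded by an orientation of the edges
   outside E: D(v) + 1 is the number of edges oriented towards v. The maximal cells
   are exactly those of the complements of the spanning trees T, with D = - v0, and
   the faces of such a cell are given by orienting some of the edges outside T.

   An isomorphism of complexes maps maximal cells to maximal cells and, being affine
   on each of them, sends all the sides of a box in the direction e to sides in one
   direction eps e, run through in the same sense s e. Two trees U - f and U - g such
   that f and g have a common end give boxes which share sides in all the other
   directions, and such exchanges connect all the trees which avoid a given edge, so
   eps e and s e depend on e only. Then eps preserves lengths and spanning trees, and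
   comparing the vertices of the boxes of U - f and U - g shows that, with the
   half-edges matched by s, f and g have a common end iff eps f and eps g do.

   Two distinct edges of the same block which have a common end always are such a
   pair f, g, because they are consecutive edges of a cycle. Hence eps maps blocks to
   blocks and induces on each of them a bijection between the vertices. *)

(** * Spanning trees and exchanges *)

(** A bijection of edges that preserves spanning trees determines a graph only up to Whitney's
    2-isomorphisms, which may rearrange the vertices inside a block. So the matroid is not enough,
    and the zero-dimensional cells are used, whose divisors record towards which vertices the edges
    point. Another obstacle is a cut of two edges: no tree avoids both, so no box has both
    directions, and [eps] is shown to separate them by exchanging one for the other in a tree.
    Points of the quotient are compared through two functions that the gluing preserves: the
    interior coordinates and the divisor of the face. The sense in which a side is run through is
    read at a quarter of it, since a reversal fixes the midpoint. *)

Section Trees.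
Variable G : mgraph.
Implicit Types (A B T U : {set edge G}) (e f g z : edge G) (u v w x y : vert G).

Definition linked A := connect (@adjacent G setT A).

Definition touches e v : bool := (src e == v) || (tgt e == v).

Lemma touches_end e b : touches e (edge_end e b).
Proof. by case: b; rewrite /touches /= eqxx ?orbT. Qed.

Lemma touchesP e v : reflect (exists b, edge_end e b = v) (touches e v).
Proof.
apply: (iffP idP) => [/orP[]/eqP<-|[b <-]]; last exact: touches_end.
  by exists false.
by exists true.
Qed.

Lemma adjacentP A u v :
  reflect (exists2 e, e \in A & exists b, edge_end e b = u /\ edge_end e (~~ b) = v)
          (adjacent setT A u v).
Proof.
rewrite /adjacent !inE /=; apply: (iffP existsP).
  move=> [e /andP[eA /orP[]/andP[/eqP su /eqP tv]]]; exists e => //.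
    by exists false.
  by exists true.
move=> [e eA [[] [/= <- <-]]]; exists e; rewrite eA /= !eqxx ?orbT //.
Qed.

Lemma adjacent_sym A : symmetric (@adjacent G setT A).
Proof.
by move=> u v; apply/adjacentP/adjacentP => -[e eA [b [? ?]]]; exists e => //;
  exists (~~ b); rewrite negbK.
Qed.

Lemma linked_sym A : connect_sym (@adjacent G setT A).
Proof. exact/sym_connect_sym/adjacent_sym. Qed.

Lemma linkedC A u v : linked A u v = linked A v u.
Proof. exact: linked_sym. Qed.

Lemma linked_trans A : transitive (linked A).
Proof. exact: connect_trans. Qed.

Lemma linked0 A u : linked A u u.
Proof. exact: connect0. Qed.

Lemma linked_ends A e b c : e \in A -> linked A (edge_end e b) (edge_end e c).
Proof.
move=> eA; have [->|ne] := eqVneq c b; first exact: linked0.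
apply/connect1/adjacentP; exists e => //; exists b; split=> //.
by case: b c ne => [] [].
Qed.

Lemma linked_inv A (P : pred (vert G)) :
  (forall e, e \in A -> P (src e) = P (tgt e)) ->
  forall u v, linked A u v -> P u = P v.
Proof.
move=> PA u v /(@closed_connect _ _ P); apply=> x y /adjacentP[e /PA eP].
by case=> -[] /= [<- <-].
Qed.

Lemma linked_trans_ends A B u v :
  (forall e, e \in A -> linked B (src e) (tgt e)) -> linked A u v -> linked B u v.
Proof.
move=> AB /(@linked_inv A (linked B u)) <-; first exact: linked0.
by move=> e /AB l; apply: (same_connect_r (@linked_sym B) l).
Qed.

Lemma linked_sub A B u v : A \subset B -> linked A u v -> linked B u v.
Proof.
move=> /subsetP AB; apply: linked_trans_ends => e /AB eB.
exact: (@linked_ends _ _ false true).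
Qed.

Definition spanning A := connected_on [set: vert G] A.

Lemma spanningP A : reflect (forall u v, linked A u v) (spanning A).
Proof.
apply: (iffP forall_inP) => [AP u v | AP u _].
  by have /forall_inP := AP u (in_setT _); apply; rewrite inE.
by apply/forall_inP => v _; apply: AP.
Qed.

Lemma spanning_sub A B : A \subset B -> spanning A -> spanning B.
Proof. by move=> AB /spanningP h; apply/spanningP => u v; apply: linked_sub (h u v). Qed.

Lemma spanning_edges A B :
  (forall e, e \in A -> linked B (src e) (tgt e)) -> spanning A -> spanning B.
Proof.
by move=> AB /spanningP h; apply/spanningP => u v; apply: linked_trans_ends AB (h u v).
Qed.

Lemma leaving_edge A (W : {set vert G}) u v :
  linked A u v -> u \in W -> v \notin W ->
  exists2 e, e \in A & exists b, edge_end e b \in W /\ edge_end e (~~ b) \notin W.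
Proof.
move=> uv uW vW.
have [/exists_inP[e eA ne]|/exists_inPn AW] :=
  boolP [exists e in A, (src e \in W) != (tgt e \in W)].
  exists e => //; exists (src e \notin W).
  by case sW: (src e \in W) ne; case tW: (tgt e \in W) => //= _; rewrite ?sW ?tW.
suff: (u \in W) = (v \in W) by rewrite uW (negPf vW).
apply: (linked_inv (P := mem W)) uv => e eA /=.
by have := AW e eA; rewrite negbK => /eqP.
Qed.

(** Prim's construction started from the whole set [W]: each step takes an edge leaving the set and
    adds its new end. A single vertex gives spanning trees; a general [W] bounds the number of tree
    edges inside [W], which are disjoint from [B]. *)
Lemma grow A (W : {set vert G}) : spanning A -> W != set0 ->
  exists B, [/\ B \subset A, (#|B| + #|W| = #|vert G|)%N,
    forall w, exists2 u, u \in W & linked B u w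
    & forall e, e \in B -> ~~ ((src e \in W) && (tgt e \in W))].
Proof.
move=> /spanningP cA; have [n] := ubnP #|~: W|; elim: n W => // n IHn W ltn.
case/set0Pn=> x xW; have [sW|] := eqVneq (~: W) set0.
  have WT : W = setT by apply/eqP; rewrite -subTset -setCS setCT sW subxx.
  exists set0; rewrite sub0set cards0 WT cardsT; split=> // [w|e]; last by rewrite inE.
  by exists w; rewrite ?inE // linked0.
case/set0Pn => y; rewrite inE => yW.
have [e eA [b [eW e'W]]] := leaving_edge (cA x y) xW yW.
set w := edge_end e (~~ b) in e'W *.
have [||B [BA cB lB eB]] := IHn (w |: W).
- by move: ltn; rewrite (cardsD1 w (~: W)) inE e'W add1n setCU setIC setDE.
- by apply/set0Pn; exists w; rewrite !inE eqxx.
have eNB : e \notin B.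
  apply/negP => /eB; rewrite !inE; move: eW; rewrite /w.
  by case: (b) => /= ->; rewrite eqxx ?orbT.
exists (e |: B); split.
- by rewrite subUset sub1set eA.
- by rewrite cardsU1 eNB -cB cardsU1 e'W add1n addSnnS addnA.
- move=> z; have [u] := lB z; rewrite !inE => /orP[/eqP->|uW] uz.
    exists (edge_end e b) => //; apply: linked_trans (linked_sub _ uz); last exact: subsetUr.
    by apply: linked_ends; rewrite !inE eqxx.
  by exists u => //; apply: linked_sub uz; apply: subsetUr.
move=> f; rewrite !inE => /orP[/eqP->|/eB]; last first.
  by apply: contra => /andP[sW tW]; rewrite !inE sW tW !orbT.
by move: e'W; rewrite /w; case: (b) => /= /negPf->; rewrite ?andbF.
Qed.

(** Acyclicity is encoded by the number of edges, so that after an exchange only connectedness has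
    to be checked. *)
Definition tree T := spanning T && (#|T|.+1 == #|vert G|).

Lemma tree_spanning T : tree T -> spanning T.
Proof. by case/andP. Qed.

Lemma tree_card T : tree T -> #|T|.+1 = #|vert G|.
Proof. by case/andP=> _ /eqP. Qed.

Lemma tree_in A (v : vert G) : spanning A -> exists2 T : {set edge G}, T \subset A & tree T.
Proof.
move=> cA; have [|B [BA cB lB _]] := grow cA (W := [set v]).
  by apply/set0Pn; exists v; rewrite inE.
exists B => //; rewrite /tree -cB cards1 addn1 eqxx andbT.
have lv w : linked B v w by have [u /set1P->] := lB w.
by apply/spanningP => x y; apply: linked_trans (lv y); rewrite linkedC.
Qed.

Lemma spanning_card A : (0 < #|vert G|)%N -> spanning A -> (#|vert G| <= #|A|.+1)%N.
Proof.
case/card_gt0P=> v _ cA; have [B BA /tree_card <-] := tree_in v cA.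
by rewrite ltnS subset_leq_card.
Qed.

Lemma tree_in_tree A T : spanning A -> tree T -> A \subset T -> A = T.
Proof.
move=> cA tT AT; apply/eqP; rewrite eqEcard AT -ltnS (tree_card tT).
by apply: spanning_card => //; rewrite -(tree_card tT).
Qed.

Lemma tree_del T e : tree T -> e \in T -> ~~ linked (T :\ e) (src e) (tgt e).
Proof.
move=> tT eT; apply/negP => le.
suff /tree_in_tree : spanning (T :\ e).
  by move=> /(_ _ tT (subsetDl _ _)) /setP/(_ e); rewrite !inE eqxx eT.
apply: spanning_edges (tree_spanning tT) => f fT.
have [->//|ne] := eqVneq f e.
by apply: (@linked_ends _ _ false true); rewrite !inE ne.
Qed.

Lemma tree_loopless T e : tree T -> e \in T -> src e != tgt e.
Proof.
by move=> tT eT; apply: contra (tree_del tT eT) => /eqP->; apply: linked0.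
Qed.

Lemma tree_split T e b w : tree T ->
  linked (T :\ e) (edge_end e b) w || linked (T :\ e) (edge_end e (~~ b)) w.
Proof.
move=> /tree_spanning/spanningP/(_ (edge_end e b) w).
move=> /(@linked_inv T (fun w => linked (T :\ e) (edge_end e b) w ||
  linked (T :\ e) (edge_end e (~~ b)) w)) <-; first by rewrite linked0.
move=> f fT; have [->|ne] := eqVneq f e.
  by case: b; rewrite /= !linked0 ?orbT.
have l : linked (T :\ e) (src f) (tgt f).
  by apply: (@linked_ends _ _ false true); rewrite !inE ne.
by congr (_ || _); apply: (same_connect_r (@linked_sym _) l).
Qed.

(** [grow] finds [#|vert G| - #|W|] edges of [T] that do not lie inside [W], out of the
    [#|vert G| - 1] edges of [T]. *)
Lemma tree_forest T (W : {set vert G}) : tree T -> W != set0 ->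
  (#|[set e in T | (src e \in W) && (tgt e \in W)]| < #|W|)%N.
Proof.
move=> tT W0; have [B [BT cB _ eB]] := grow (tree_spanning tT) W0.
set I := [set e in T | _].
have dIB : [disjoint I & B].
  rewrite disjoint_subset; apply/subsetP => e; rewrite !inE => /andP[_ eW].
  by apply/negP => /eB; rewrite eW.
have := subset_leq_card (_ : I :|: B \subset T).
rewrite subUset BT andbT cardsU (disjoint_setI0 dIB) cards0 subn0.
have IT : I \subset T by apply/subsetP => e; rewrite inE => /andP[].
move=> /(_ IT); rewrite -ltnS (tree_card tT) -cB.
by rewrite -addSn addnC leq_add2l.
Qed.

Lemma card_swap U f g : f \in U -> g \in U -> #|U :\ f| = #|U :\ g|.
Proof.
move=> fU gU; have := cardsD1 f U; have := cardsD1 g U.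
by rewrite fU gU !add1n => -> [->].
Qed.

Definition share e f : bool := [exists b, exists c, edge_end e b == edge_end f c].

Lemma shareP e f : reflect (exists b c, edge_end e b = edge_end f c) (share e f).
Proof.
apply: (iffP existsP) => [[b /existsP[c /eqP h]]|[b [c h]]]; first by exists b, c.
by exists b; apply/existsP; exists c; rewrite h.
Qed.

Lemma share_sym : symmetric share.
Proof. by move=> e f; apply/shareP/shareP => -[b [c h]]; exists c, b. Qed.

(** [U] is connected with a single cycle, and [f] lies on this cycle. *)
Definition exchangeable U f : bool := (f \in U) && tree (U :\ f).

(* f and g are consecutive edges of the only cycle of U *)
Definition neighbours U f g : bool :=
  [&& exchangeable U f, exchangeable U g, f != g & share f g].

Lemma neighbours_sym U : symmetric (neighbours U).
Proof.
by move=> f g; rewrite /neighbours andbCA share_sym eq_sym.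
Qed.

Lemma exchangeable_swap U f z : exchangeable U f -> z \in U -> z != f ->
  linked (U :\ z) (src z) (tgt z) -> exchangeable U z.
Proof.
move=> /andP[fU tU] zU zf lz; rewrite /exchangeable zU /tree.
rewrite (card_swap zU fU) (tree_card tU) eqxx andbT.
apply: spanning_edges (tree_spanning tU) => e; rewrite !inE => /andP[ef eU].
have [->//|ez] := eqVneq e z.
by apply: (@linked_ends _ _ false true); rewrite !inE ez.
Qed.

Lemma exchangeable_loopless U f g : exchangeable U f -> exchangeable U g -> f != g ->
  src f != tgt f.
Proof.
move=> /andP[fU _] /andP[_ tU] ne; apply: tree_loopless tU _.
by rewrite !inE ne.
Qed.

Lemma linked_avoid A x v p : path (adjacent setT A) x p -> v \notin x :: p ->
  linked [set e in A | ~~ touches e v] x (last x p).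
Proof.
elim: p x => [|y p IHp] x /=; first by rewrite linked0.
case/andP=> /adjacentP[e eA [b [ex ey]]] /IHp{}IHp.
rewrite inE negb_or => /andP[vx vp]; apply: linked_trans (IHp vp).
rewrite -ex -ey; apply: linked_ends; rewrite !inE eA /=.
apply/touchesP => -[c ec]; move: vx vp; rewrite inE negb_or -ex -ey -ec.
by case: b c {ex ey ec} => [] [] /=; rewrite eqxx ?andbF.
Qed.

(* The edges z on the path in the tree U \ f between the ends of f, which with f
   form the only cycle of U, are all reached from f by moves between consecutive
   edges of this cycle. *)
Lemma exchange_cycle U f : exchangeable U f ->
  linked [set z | (z != f) && connect (neighbours U) f z] (src f) (tgt f).
Proof.
move=> eUf; have /andP[fU tU] := eUf; set Z := [set z | _].
have /spanningP/(_ (src f) (tgt f))/connectP[p0 p0P lp0] := tree_spanning tU.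
case: (shortenP p0P) lp0 => p pP pu _ lp {p0 p0P}.
(* Induction on the prefixes of the path. Besides the link in [Z], the invariant keeps an edge [h]
   of the cycle which is already reached and touches the current vertex. *)
suff H p1 p2 : p1 ++ p2 = p -> linked Z (src f) (last (src f) p1) /\
    exists h, [/\ connect (neighbours U) f h, exchangeable U h
                & touches h (last (src f) p1)].
  by rewrite lp; case: (H p [::]) => //; rewrite cats0.
elim/last_ind: p1 p2 => [|p1 w' IH] p2.
  move=> _; split; first exact: linked0.
  by exists f; rewrite connect0 eUf /= /touches eqxx.
rewrite cat_rcons => def_p; have [lw [h [fh eUh hw]]] := IH _ def_p.
rewrite last_rcons; set w := last _ _ in lw hw *.
move: pP; rewrite -def_p cat_path -/w => /andP[p1P /andP[ww' p2P]].
move: pu; rewrite -def_p -cat_cons cat_uniq => /and3P[u1 /hasPn p2w /andP[w'2 u2]].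
have w'1 := p2w w' (mem_head _ _).
move: lp; rewrite -def_p last_cat /= => lp.
have [z zU [b [zw zw']]] := adjacentP _ _ _ ww'.
have zf : z != f by move: zU; rewrite !inE => /andP[].
have zU' : z \in U by move: zU; rewrite !inE => /andP[].
have ww : w \in src f :: p1 by apply: mem_last.
have sub v : touches z v ->
    [set e in U :\ f | ~~ touches e v] \subset U :\ z.
  move=> zv; apply/subsetP => e; rewrite !inE => /andP[/andP[ef ->]]; rewrite andbT.
  by apply: contra => /eqP->.
(* The ends of [z] stay linked around the rest of the cycle: back along [p1] to [src f], across [f],
   and back along [p2] from [tgt f]. Hence [z] is exchangeable. *)
have lz : linked (U :\ z) w w'.
  have zw'T : touches z w' by rewrite -zw' touches_end.
  have zwT : touches z w by rewrite -zw touches_end.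
  have w2 : w \notin w' :: p2 by apply: contraL ww => /p2w.
  have l1 := linked_sub (sub w' zw'T) (linked_avoid p1P w'1).
  have l2 := linked_sub (sub w zwT) (linked_avoid p2P w2).
  have l3 : linked (U :\ z) (src f) (tgt f).
    by apply: (@linked_ends _ _ false true); rewrite !inE eq_sym zf.
  rewrite linkedC; apply: linked_trans l1; rewrite linkedC.
  by apply: linked_trans l3 _; rewrite lp linkedC.
have eUz : exchangeable U z.
  apply: exchangeable_swap eUf zU' zf _.
  by case: b zw zw' lz => /= -> ->; rewrite // linkedC.
have fz : connect (neighbours U) f z.
  have [<-//|hz] := eqVneq h z; apply: connect_trans fh (connect1 _).
  rewrite /neighbours eUh eUz hz; apply/shareP.
  by have /touchesP[c hc] := hw; exists c, b; rewrite hc zw.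
split; last by exists z; rewrite eUz fz -zw' touches_end.
apply: linked_trans lw _; rewrite -zw -zw'; apply: linked_ends.
by rewrite inE zf fz.
Qed.

(** The rest of the cycle links the distinct ends of [f], so it has an edge; the first move towards
    this edge gives the neighbour. *)
Lemma exchangeable_neighbour U f : exchangeable U f -> src f != tgt f ->
  exists z, neighbours U f z.
Proof.
move=> eUf ne; have /exists_inP[z]: [exists z in [set z | (z != f) &&
    connect (neighbours U) f z], true].
  apply: contraR ne => /exists_inPn Z0; apply/eqP/esym.
  have := exchange_cycle eUf; apply: contraTeq => ne.
  apply/negP => /(linked_inv (P := pred1 (src f))) /=.
  rewrite eqxx (negPf ne) => h; have // : true = false by apply: h => e /Z0.
rewrite inE => /andP[zf /connectP[[|y p] /= ]]; first by move=> _ ez; rewrite ez eqxx in zf.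
by case/andP => fy _ _ _; exists y.
Qed.

(** Basis exchange in small steps. For [g] in [T'] outside [T], the cycle of [g |: T] cannot lie in
    [T'], so it has an edge [z] outside [T']. Moving the removed edge from [g] to [z] along
    consecutive edges of the cycle carries [Q] to a tree closer to [T'], and [g |: T] does not
    contain [e]. *)
Lemma tree_chain (e : edge G) (Q : {set edge G} -> Prop) :
  (forall U f g, neighbours U f g -> e \notin U -> Q (U :\ f) -> Q (U :\ g)) ->
  forall T T', tree T -> tree T' -> e \notin T -> e \notin T' -> Q T -> Q T'.
Proof.
move=> QS T T' tT tT' eT eT'; have [n] := ubnP #|T :\: T'|.
elim: n T tT eT => // n IHn T tT eT ltn QT.
have [/tree_in_tree->//|/subsetPn[g gT' gT]] := boolP (T' \subset T).
  exact: tree_spanning.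
set U := g |: T; have UgT : U :\ g = T.
  by apply/setP => h; rewrite !inE; case: eqVneq => // ->; rewrite (negPf gT).
have eUg : exchangeable U g by rewrite /exchangeable UgT tT !inE eqxx.
have eU : e \notin U by rewrite !inE negb_or eT andbT; apply: contraNneq eT' => ->.
have [/subsetP ZT|] := boolP ([set z | (z != g) && connect (neighbours U) g z]
    \subset T' :\ g).
  have := tree_del tT' gT'; rewrite (linked_sub _ (exchange_cycle eUg)) //.
  exact/subsetP.
case/subsetPn => z; rewrite !inE => /andP[zg gz]; rewrite zg /= => zT'.
have [QUz eUz] : Q (U :\ z) /\ exchangeable U z.
  have /connectP[p pP ->] := gz; have QUg : Q (U :\ g) by rewrite UgT.
  elim: p (g) eUg QUg pP {gT gT' UgT zg gz} => //= y p IHp x eUx QUx /andP[xy].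
  by apply: IHp; [case/and4P: xy | apply: QS xy eU QUx].
have /andP[zU tUz] := eUz; apply: IHn tUz _ _ QUz.
  by rewrite in_setD1 (negPf eU) andbF.
rewrite -ltnS; apply: leq_trans ltn; rewrite ltnS; apply: proper_card.
have zT : z \in T by move: zU; rewrite !inE (negPf zg).
apply/properP; split; last by exists z; rewrite !inE ?zT ?zT' // eqxx.
apply/subsetP => h; rewrite !inE => /and3P[hT' hz /orP[/eqP hg|hT]].
  by rewrite hg gT' in hT'.
by rewrite hT hT'.
Qed.

End Trees.

(** * Biconnected graphs *)

Section Subdivisions.
Variables (H : mgraph) (n : edge H -> nat).
Implicit Types (e : edge H) (v : vert H) (x y : vert (subdivision n)).

Definition reach x := connect (adjacent [set~ x] [set: edge (subdivision n)]).

Lemma reachC x y z : reach x y z = reach x z y.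
Proof.
apply: sym_connect_sym => {}y {}z; rewrite /adjacent.
rewrite andbCA; congr [&& _, _ & _].
by apply: eq_existsb => e; rewrite orbC.
Qed.

Lemma reach_trans x : transitive (reach x).
Proof. exact: connect_trans. Qed.

Lemma sub_point_in e k (kn : (k < n e)%N) :
  sub_point n e k.+1 = inr (Tagged (fun e => 'I_(n e)) (Ordinal kn)).
Proof. by rewrite /sub_point insubT. Qed.

Lemma sub_point_last e : sub_point n e (n e).+1 = inl (tgt e).
Proof. by rewrite /sub_point insubF // ltnn. Qed.

Lemma sub_point_tag e k x : (k <= (n e).+1)%N -> sub_point n e k = x ->
  match x with
  | inl v => (k = 0%N /\ src e = v) \/ (k = (n e).+1 /\ tgt e = v)
  | inr a => tag a = e /\ k = (tagged a).+1
  end.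
Proof.
case: k => [|k]; first by move=> _ <- /=; left.
rewrite ltnS leq_eqVlt => /orP[/eqP->|kn <-]; last by rewrite sub_point_in.
by rewrite sub_point_last => <-; right.
Qed.

Lemma reach_segment x e k l : (k <= l <= (n e).+1)%N ->
  (forall i, (k <= i <= l)%N -> sub_point n e i != x) ->
  reach x (sub_point n e k) (sub_point n e l).
Proof.
case/andP; elim: l => [|l IHl]; first by rewrite leqn0 => /eqP->; rewrite /reach connect0.
rewrite leq_eqVlt => /orP[/eqP->|]; first by rewrite /reach connect0.
rewrite ltnS => kl ln Nx; apply: connect_trans (IHl kl (ltnW ln) _) (connect1 _).
  by move=> i /andP[ki il]; apply: Nx; rewrite ki ltnW.
have N1 : sub_point n e l != x by apply: Nx; rewrite kl leqnSn.
have N2 : sub_point n e l.+1 != x by apply: Nx; rewrite leqnn andbT ltnW.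
rewrite /adjacent !inE N1 N2 /=; apply/existsP.
exists (Tagged (fun e => 'I_(n e).+1) (Ordinal ln)); rewrite inE /=.
by rewrite !eqxx.
Qed.

(** At most one side of the point is blocked by [x], and the way out is the other one. The condition
    excludes a loop at a removed vertex [x], where both sides would be blocked. *)
Lemma reach_end x e (i : 'I_(n e)) :
  inr (Tagged (fun e => 'I_(n e)) i) != x ->
  (if x is inl _ then src e != tgt e else true) ->
  exists2 v, inl v != x & reach x (inr (Tagged (fun e => 'I_(n e)) i)) (inl v).
Proof.
move=> ix ne; set y := inr _ in ix *.
have yE : y = sub_point n e i.+1.
  by rewrite (sub_point_in (ltn_ord i)) /y; congr (inr (Tagged _ _)); apply: val_inj.
have fwd : (forall j, (i < j <= (n e).+1)%N -> sub_point n e j != x) ->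
    exists2 v, inl v != x & reach x y (inl v).
  move=> h; exists (tgt e).
    by rewrite -sub_point_last; apply: h; rewrite leqnn andbT ltnS ltnW.
  rewrite yE -sub_point_last; apply: reach_segment; first by rewrite leqnn andbT ltnS ltnW.
  by move=> j /h.
have bwd : (forall j, (j <= i.+1)%N -> sub_point n e j != x) ->
    exists2 v, inl v != x & reach x y (inl v).
  move=> h; exists (src e); first exact: (h 0%N).
  rewrite yE reachC; apply: (@reach_segment x e 0%N).
    by rewrite /= !ltnS ltnW.
  by move=> j /h.
have leS j : (j <= i.+1)%N -> (j <= (n e).+1)%N.
  by move=> h; apply: leq_trans h _; rewrite ltnS ltnW.
case: x ix ne fwd bwd => [v|[f k]] ix ne fwd bwd.
  have [sv|sv] := eqVneq (src e) v.
    apply: fwd => j /andP[ij jn]; apply/eqP => /(sub_point_tag jn) /=.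
    case=> [[j0 _]|[_ tv]]; first by rewrite j0 in ij.
    by rewrite sv tv eqxx in ne.
  apply: bwd => j ji; apply/eqP => /(sub_point_tag (leS _ ji)) /=.
  case=> [[_ /eqP sv']|[jn _]]; first by rewrite (negPf sv) in sv'.
  by move: ji; rewrite jn ltnS leqNgt ltn_ord.
have [fe|fe] := eqVneq f e; last first.
  apply: bwd => j ji; apply/eqP => /(sub_point_tag (leS _ ji)) /= [/eqP].
  by rewrite (negPf fe).
have ki : val k != val i.
  by subst f; apply: contra ix => /eqP/val_inj->.
have [lt_ik|le_ki] := ltnP i k.
  apply: bwd => j ji; apply/eqP => /(sub_point_tag (leS _ ji)) /= [_ jk].
  by move: ji; rewrite jk ltnS leqNgt lt_ik.
apply: fwd => j /andP[ij jn]; apply/eqP => /(sub_point_tag jn) /= [_ jk].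
by move: ij; rewrite jk ltnS leq_eqVlt [_ == _]eq_sym (negPf ki) ltnNge le_ki.
Qed.

End Subdivisions.

Section Biconnected.
Variable H : mgraph.
Implicit Types (e f : edge H) (u v w : vert H).

Definition avoiding v := [set e | ~~ touches e v].

Lemma connected_onP (n : edge H -> nat) (x : vert (subdivision n)) :
  (forall y z, y != x -> z != x -> reach x y z) ->
  connected_on [set~ x] [set: edge (subdivision n)].
Proof.
move=> h; apply/forall_inP => y yx; apply/forall_inP => z zx.
by rewrite !inE in yx zx; apply: h.
Qed.

Lemma reach_linked (n : edge H -> nat) (x : vert (subdivision n)) (A : {set edge H}) u v :
  (forall e k, e \in A -> (k <= (n e).+1)%N -> sub_point n e k != x) ->
  linked A u v -> reach x (inl u) (inl v).
Proof.
move=> Ax; rewrite /linked.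
move/(@linked_inv _ _ (fun w => reach x (inl u) (inl w))) <-; first by rewrite /reach connect0.
move=> e eA; suff l : reach x (inl (src e)) (inl (tgt e)).
  exact: (same_connect_r (@reachC _ _ x) l).
rewrite -sub_point_last; apply: (@reach_segment _ _ x e 0%N); first by rewrite leqnn.
move=> i /andP[_].
exact: Ax.
Qed.

(** Removing an original vertex [v] of a subdivision leaves the paths that avoid the edges at [v];
    removing a vertex inserted in [e] leaves those that avoid [e]. Loops are excluded because the
    vertices inserted in a loop are cut off by the removal of its end. *)
Lemma biconnected_crit :
  graph_connected H ->
  (forall v u w, u != v -> w != v -> linked (avoiding v) u w) ->
  (forall e u w, linked [set~ e] u w) ->
  (forall e, src e != tgt e) ->
  biconnected H.
Proof.
move=> cH av ae nl; split=> // n x; apply: connected_onP.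
have lk u w : inl u != x -> inl w != x -> reach x (inl u) (inl w).
  case: x => [v|[e i]] ux wx.
    apply: (reach_linked _ (av v u w ux wx)) => e k; rewrite inE => ev kn.
    apply/eqP => /(sub_point_tag kn) /= [] [_ h]; rewrite -h in ev.
      by have := touches_end e false; rewrite (negPf ev).
    by have := touches_end e true; rewrite (negPf ev).
  apply: (reach_linked _ (ae e u w)) => f k; rewrite !inE => fe kn.
  by apply/eqP => /(sub_point_tag kn) /= [h]; rewrite h eqxx in fe.
have toV y : y != x -> exists2 u, inl u != x & reach x y (inl u).
  case: y => [u ux|[e i] yx]; first by exists u; rewrite ?/reach ?connect0.
  by apply: reach_end => //; case: (x).
move=> y z /toV[u ux yu] /toV[w wx zw].
by apply: reach_trans yu _; apply: reach_trans (lk u w ux wx) _; rewrite reachC.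
Qed.

(** This serves the isolated vertex and the single loop. Without its vertex a subdivided loop is a
    segment; without an inserted vertex everything is still joined to [v]. *)
Lemma biconnected_point v : (forall u, u = v) -> (forall e f, e = f) -> biconnected H.
Proof.
move=> vE eE; split.
  apply/andP; split; first by apply/card_gt0P; exists v.
  by apply/spanningP => u w; rewrite (vE u) (vE w) linked0.
move=> n x; apply: connected_onP; case: x => [v'|a].
  case=> [u|[e i]] [w|[f j]]; rewrite ?(vE u) ?(vE w) ?(vE v') ?eqxx //.
  move=> _ _; case: _ / (eE e f) j => {f} j.
  wlog ij : i j / (i <= j)%N.
    by case: (leqP i j) => [ij|/ltnW ij] h; [|rewrite reachC]; apply: h.
  have pE (k : 'I_(n e)) : inr (Tagged (fun e => 'I_(n e)) k) = sub_point n e k.+1.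
    by rewrite (sub_point_in (ltn_ord k)); congr (inr (Tagged _ _)); apply: val_inj.
  rewrite !pE; apply: reach_segment; first by rewrite !ltnS ij ltnW.
  case=> // k; rewrite !ltnS => /andP[_ kj].
  by rewrite (sub_point_in (leq_ltn_trans kj (ltn_ord j))).
suff toV y : y != inr a -> reach (inr a) y (inl v).
  by move=> y z /toV yv /toV zv; apply: reach_trans yv _; rewrite reachC.
case: y => [u _|[e i] yx]; first by rewrite (vE u) /reach connect0.
by have [u _] := reach_end yx isT; rewrite (vE u).
Qed.

(** Each edge is subdivided once. After the removal of the common end, the midpoints of [e] and [f]
    are still joined, and a path between them leaves them through their other ends. *)
Lemma biconnected_avoid e f b c : biconnected H -> e != f ->
  edge_end e b = edge_end f c ->
  [/\ edge_end e (~~ b) != edge_end e b, edge_end f (~~ c) != edge_end e b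
    & linked (avoiding (edge_end e b)) (edge_end e (~~ b)) (edge_end f (~~ c))].
Proof.
pose n := fun _ : edge H => 1%N; move=> [_ /(_ n)]; set v := edge_end e b.
set a := edge_end e (~~ b) => bi ef vE.
pose mid g : vert (subdivision n) := inr (@Tagged _ g (fun e => 'I_(n e)) (@ord0 0)).
(* A set closed under adjacency that contains the midpoint of [e]: the vertices linked to [a] away
   from [v], the midpoints of the edges at these vertices, and [mid e] itself. *)
pose P (x : vert (subdivision n)) : bool := match x with
  | inl w => (w != v) && linked (avoiding v) a w
  | inr g => (tag g == e) ||
     [exists w, [&& touches (tag g) w, w != v & linked (avoiding v) a w]]
  end.
have st (g : edge H) (i : 'I_(n g)) d : edge_end g d != v ->
    P (inl (edge_end g d)) = P (inr (Tagged (fun e => 'I_(n e)) i)).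
  move=> dv; rewrite /= dv /=; apply/idP/orP => [ad|].
    by right; apply/existsP; exists (edge_end g d); rewrite touches_end dv.
  case=> [/eqP ge|/existsP[w /and3P[/touchesP[d' <-] wv aw]]].
    suff -> : edge_end g d = a by apply: linked0.
    by rewrite ge /a; case: (eqVneq d b) dv => [->|]; rewrite ge ?eqxx //; case: d (b) => [] [].
  apply: linked_trans aw _; have [->|dd] := eqVneq d d'; first exact: linked0.
  apply: linked_ends; rewrite inE; apply/touchesP => -[d'' gd''].
  by move: dv wv; rewrite -gd''; case: d d' d'' {gd''} dd => [] [] [] //=; rewrite eqxx.
have bP : closed (adjacent [set~ (inl v : vert (subdivision n))]
    [set: edge (subdivision n)]) P.
  move=> x y; rewrite /adjacent !inE => /and3P[xv yv /exists_inP[[g i] _]].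
  have sE : @src (subdivision n) (Tagged (fun e => 'I_(n e).+1) i) = sub_point n g i by [].
  have tE : @tgt (subdivision n) (Tagged (fun e => 'I_(n e).+1) i) = sub_point n g i.+1 by [].
  rewrite sE tE.
  suff h : sub_point n g i != inl v -> sub_point n g i.+1 != inl v ->
      P (sub_point n g i) = P (sub_point n g i.+1).
    by move=> /orP[]/andP[/eqP ix /eqP iy]; move: h; rewrite ix iy => h;
      rewrite -!topredE /= h.
  case: i {sE tE} => [[|[|//]]] ltn.
    by rewrite (sub_point_in (isT : 0 < n g)%N) => sv _; apply: (st g _ false).
  rewrite sub_point_last (sub_point_in (isT : 0 < n g)%N) => _ tv.
  by apply/esym; apply: (st g _ true).
have := bi (inl v) => /forall_inP/(_ (mid e)).
rewrite !inE => /(_ isT) /forall_inP/(_ (mid f)); rewrite !inE => /(_ isT).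
move=> /(closed_connect bP); rewrite -!topredE /= eqxx /= => /esym.
rewrite eq_sym (negPf ef) /= => /existsP[w /and3P[/touchesP[d <-] wv aw]].
have dc : d = ~~ c by apply: contraNeq wv; case: d c vE {aw} => [] [] // -> _ .
rewrite dc in wv aw; split=> //; apply: contra wv => /eqP av.
move: aw; rewrite av => /(linked_inv (P := pred1 v)) /=; rewrite eqxx => <- //.
move=> g; rewrite inE /touches negb_or => /andP[/negPf-> /negPf->] //.
Qed.

End Biconnected.

(** * Blocks *)

Section Blocks.
Variable G : mgraph.
Hypothesis cG : graph_connected G.
Implicit Types (A T U : {set edge G}) (e f g z : edge G) (u v w : vert G).

Lemma graph_vert : exists v : vert G, true.
Proof. by case/andP: cG => /card_gt0P[v _] _; exists v. Qed.

Lemma graph_spanning : spanning [set: edge G].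
Proof. by case/andP: cG. Qed.

Lemma linked_add A e u v : linked (e |: A) u v -> ~~ linked A u v ->
  exists b, linked A u (edge_end e b) /\ linked A (edge_end e (~~ b)) v.
Proof.
have leave x y : linked (e |: A) x y -> ~~ linked A x y ->
    exists b, linked A x (edge_end e b) /\ ~~ linked A x (edge_end e (~~ b)).
  move=> xy Nxy; have xW : x \in [set w | linked A x w] by rewrite inE linked0.
  have yW : y \notin [set w | linked A x w] by rewrite inE.
  have [f fA [b]] := leaving_edge xy xW yW; rewrite !inE => -[xb Nxb].
  move: fA; rewrite !inE => /orP[/eqP<-|fA]; first by exists b.
  by case/negP: Nxb; apply: linked_trans xb (linked_ends _ _ fA).
move=> uv Nuv; have [b [ub Nub]] := leave _ _ uv Nuv; exists b; split=> //.
rewrite linkedC in uv; rewrite linkedC in Nuv.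
have [c [vc _]] := leave _ _ uv Nuv; rewrite linkedC.
suff -> : ~~ b = c by [].
apply: contraNeq Nuv => bc; have {}bc : b = c by case: b c bc {ub Nub vc} => [] [].
by apply: linked_trans vc _; rewrite -bc linkedC.
Qed.

(** A maximal set [A] of edges which contains those avoiding [v] but does not link [v] to [a] has
    two components, and both [f] and [g] go from one to the other. A spanning tree of [f |: A] must
    use [f], and adding [g] to it closes a cycle through [f]. *)
Lemma neighbours_exist f g b c : f != g -> edge_end f b = edge_end g c ->
  edge_end f (~~ b) != edge_end f b -> edge_end g (~~ c) != edge_end f b ->
  linked (avoiding (edge_end f b)) (edge_end f (~~ b)) (edge_end g (~~ c)) ->
  exists U, neighbours U f g.
Proof.
set v := edge_end f b; set a := edge_end f (~~ b); set d := edge_end g (~~ c).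
move=> fg vE av dv ad.
pose P := [pred A : {set edge G} | ~~ linked A v a].
have P0 : P (avoiding v).
  apply: contra av => /(linked_inv (P := pred1 v)) /=; rewrite eqxx => <- // h.
  by rewrite inE /touches negb_or => /andP[/negPf-> /negPf->].
have [A /maxsetP[/= NA maxA] vA] := maxset_exists P0.
have add h : h \notin A -> linked (h |: A) v a.
  apply: contraR => /= Nh; rewrite -(maxA (h |: A)) ?subsetUr //.
  by rewrite !inE eqxx.
have adA : linked A a d by exact: linked_sub vA ad.
(* By maximality each edge outside [A] joins the components of [v] and of [a], so nothing could
   connect a third component to these. *)
have two w : linked A v w || linked A a w.
  have /spanningP/(_ v w) := graph_spanning.
  pose Q w := linked A v w || linked A a w.
  move=> /(@linked_inv _ _ Q); rewrite /Q linked0 /= => <- // h _.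
  have [hA|hA] := boolP (h \in A).
    have l : linked A (src h) (tgt h) by apply: (@linked_ends _ _ _ false true).
    by congr (_ || _); apply: (same_connect_r (@linked_sym _ _) l).
  have [[] /= [vh ah]] := linked_add (add h hA) NA; rewrite linkedC in ah;
  by rewrite ah vh !orbT.
have fA : f \notin A.
  by apply: contra NA => fA; apply: linked_ends.
have gA : g \notin A.
  apply: contra NA => gA; rewrite linkedC; apply: linked_trans adA _.
  by rewrite vE; apply: linked_ends.
have sfA : spanning (f |: A).
  have va : linked (f |: A) v a by apply: linked_ends; rewrite !inE eqxx.
  have fromv w : linked (f |: A) v w.
    have /orP[|] := two w; move=> /(linked_sub (subsetUr [set f] A)) //.
    exact: linked_trans.
  by apply/spanningP => u w; apply: linked_trans (fromv w); rewrite linkedC.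
have [T /subsetP TA tT] := tree_in v sfA.
have fT : f \in T.
  apply: contraR NA => fT; have /spanningP/(_ v a) := tree_spanning tT.
  apply: (@linked_sub _ T) => //; apply/subsetP => h hT; move: (TA h hT).
  by rewrite !inE; case: eqVneq hT => // ->; rewrite (negPf fT).
have gT : g \notin T.
  by apply/negP => /TA; rewrite !inE eq_sym (negPf fg) (negPf gA).
have UgT : (g |: T) :\ g = T.
  by apply/setP => h; rewrite !inE; case: eqVneq => // ->; rewrite (negPf gT).
have eUg : exchangeable (g |: T) g by rewrite /exchangeable UgT tT !inE eqxx.
exists (g |: T); rewrite /neighbours eUg fg /= andbC.
apply/andP; split; first by apply/shareP; exists b, c.
apply: (exchangeable_swap eUg _ fg); first by rewrite !inE fT orbT.
have TfA : T :\ f \subset A.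
  apply/subsetP => h; rewrite !inE => /andP[hf /TA].
  by rewrite !inE (negPf hf).
suff va : linked ((g |: T) :\ f) v a.
  by move: va; rewrite /v /a; case: (b) => //=; rewrite linkedC.
(* [T] without [f] lies in [A], which links [a] to [d] but not to [v]; so [d] is on the side of [a],
   and [g] replaces [f]. *)
have := tree_split f b d tT; rewrite -/v -/a => /orP[vd|ad'].
  case/negP: NA; apply: linked_trans (linked_sub TfA vd) _.
  by rewrite linkedC.
have vd : linked ((g |: T) :\ f) v d.
  by rewrite vE; apply: linked_ends; rewrite !inE eqxx eq_sym fg.
apply: linked_trans vd _; rewrite linkedC.
by apply: (linked_sub _ ad'); apply: setSD; apply: subsetUr.
Qed.

Definition neighbouring f g := [exists U, neighbours U f g].

Lemma neighbouring_sym : symmetric neighbouring.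
Proof.
by move=> f g; apply: eq_existsb => U; apply: neighbours_sym.
Qed.

(** These classes turn out to be the edge sets of the biconnected components that have an edge. A
    loop is alone in its class, since an edge with a neighbour has distinct ends. *)
Definition block e := [set f | connect neighbouring e f].

Lemma neighbouring_share f g : neighbouring f g -> share f g.
Proof. by case/existsP=> U /and4P[]. Qed.

Lemma block_id e : e \in block e.
Proof. by rewrite inE connect0. Qed.

Lemma blockE e f : f \in block e -> block f = block e.
Proof.
rewrite inE => ef; apply/setP => g; rewrite !inE.
by rewrite (same_connect (sym_connect_sym neighbouring_sym) ef).
Qed.

Lemma neighbours_block U f g : connect (neighbours U) f g -> g \in block f.
Proof.
rewrite inE; apply: connect_sub => x y xy; apply: connect1.
by apply/existsP; exists U.
Qed.

Lemma neighbouring_loopless f g : neighbouring f g -> src f != tgt f.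
Proof. by case/existsP=> U /and4P[Uf Ug fg _]; apply: exchangeable_loopless Uf Ug fg. Qed.

Lemma block_loop e : src e = tgt e -> block e = [set e].
Proof.
move=> le; apply/setP => f; rewrite !inE; apply/idP/eqP => [|->]; last exact: connect0.
case/connectP=> [[|g p]] //= /andP[/neighbouring_loopless].
by rewrite le eqxx.
Qed.

Lemma block_loopless e f : src e != tgt e -> f \in block e -> src f != tgt f.
Proof.
move=> ne fe; apply/negP => /eqP lf; have bf := block_loop lf.
have := block_id e; rewrite -(blockE fe) bf inE => /eqP ef.
by rewrite ef lf eqxx in ne.
Qed.

Lemma linked_avoid_last A u v : u != v -> linked A u v ->
  exists2 e, e \in A & exists b, [/\ edge_end e b = v, edge_end e (~~ b) != v
    & linked [set f in A | ~~ touches f v] u (edge_end e (~~ b))].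
Proof.
move=> uv /connectP[p0 p0P lp0]; case: (shortenP p0P) lp0 => p pP pu _ lp {p0 p0P}.
case/lastP: p pP pu lp => [|p w]; first by move=> _ _ vu; rewrite vu eqxx in uv.
rewrite rcons_path -rcons_cons rcons_uniq last_rcons => /andP[pP ew] /andP[wp _] vw.
rewrite {}vw; have [e eA [b [eb eb']]] := adjacentP _ _ _ ew.
exists e => //; exists (~~ b); rewrite negbK eb eb'; split=> //.
  by apply: contraNneq wp => <-; apply: mem_last.
exact: linked_avoid.
Qed.

(* Two consecutive edges of a cycle at v are joined by the rest of this cycle,
   which avoids v. *)
Lemma neighbouring_avoid f g b c : neighbouring f g -> edge_end f b = edge_end g c ->
  linked [set e in block f | ~~ touches e (edge_end f b)]
         (edge_end f (~~ b)) (edge_end g (~~ c)).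
Proof.
case/existsP=> U /and4P[Uf Ug fg _]; set v := edge_end f b => vE.
set a := edge_end f (~~ b); set Z := [set z | (z != f) && connect (neighbours U) f z].
have va : linked Z a v.
  have := exchange_cycle Uf; rewrite -/Z /a /v; case: (b) => //=.
  by rewrite linkedC.
have av : a != v.
  have := exchangeable_loopless Uf Ug fg; rewrite /a /v.
  by case: (b); rewrite //= eq_sym.
have ZU : Z \subset U :\ f.
  apply/subsetP => z; rewrite !inE => /andP[-> /connectP[p]] /=.
  case/lastP: p => [_ ->|p y]; first by case/andP: Uf.
  rewrite rcons_path last_rcons => /andP[_ /and4P[_ Uy _ _]] ->.
  by case/andP: Uy.
have [z zZ [d [zv zv' az]]] := linked_avoid_last av va.
have sub : [set e in Z | ~~ touches e v] \subset
    [set e in block f | ~~ touches e v].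
  apply/subsetP => e; rewrite !inE => /andP[/andP[_ fe] ev].
  by have := neighbours_block fe; rewrite !inE ev andbT.
(* If the path entered [v] through an edge [z] other than [g], it would join the ends of [f] inside
   the tree [U :\ g] without using [f]. *)
have [zg|zg] := eqVneq z g.
  rewrite zg in zv zv' az; suff -> : c = d by exact: linked_sub sub az.
  by apply: contraNeq zv'; rewrite -zg => cd; rewrite vE zg; case: c d cd {zv az vE} => [] [].
have /andP[gU tU] := Uf; have gUf : g \in U :\ f.
  by rewrite !inE eq_sym fg; case/andP: Ug.
have /andP[_ tUg] := Ug; have fUg : f \in U :\ g.
  by rewrite !inE fg; case/andP: Uf.
case/negP: (tree_del tUg fUg).
suff : linked ((U :\ g) :\ f) a v.
  by rewrite /a /v; case: (b) => //=; rewrite linkedC.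
have s1 : [set e in Z | ~~ touches e v] \subset (U :\ g) :\ f.
  apply/subsetP => e; rewrite inE => /andP[/(subsetP ZU)]; rewrite !inE => /andP[-> ->].
  by rewrite andbT; apply: contraNneq => ->; rewrite vE touches_end.
apply: linked_trans (linked_sub s1 az) _; rewrite -zv; apply: linked_ends.
by have := subsetP ZU z zZ; rewrite !inE zg.
Qed.

Definition block_verts e := [set v | [exists f in block e, touches f v]].

Lemma block_closed e :
  [forall f in block e, (src f \in block_verts e) && (tgt f \in block_verts e)].
Proof.
apply/forall_inP => f fe; rewrite !inE; apply/andP; split; apply/exists_inP; exists f => //.
  exact: (touches_end f false).
exact: (touches_end f true).
Qed.

Definition block_sub e : subgraph G := Subgraph (block_closed e).

(** Linkage within a block is checked on one edge and on two neighbouring edges, then propagated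
    along a chain of neighbours. [P] marks the vertices that survive a removal. *)
Lemma block_ends_linked e (A : {set edge G}) (P : pred (vert G)) :
  (forall f b c, f \in block e -> P (edge_end f b) -> P (edge_end f c) ->
    linked A (edge_end f b) (edge_end f c)) ->
  (forall f g, f \in block e -> neighbouring f g -> exists b c,
    [/\ P (edge_end f b), P (edge_end g c) & linked A (edge_end f b) (edge_end g c)]) ->
  forall u v, u \in block_verts e -> v \in block_verts e -> P u -> P v -> linked A u v.
Proof.
move=> one two u v; rewrite !inE => /exists_inP[f fe /touchesP[b <-]].
case/exists_inP=> g ge /touchesP[c <-] Pf Pg.
have : connect neighbouring f g by rewrite -(blockE fe) inE in ge.
case/connectP=> p; elim: p f fe b Pf => [|h p IHp] f fe b Pf /=.
  by move=> _ gf; rewrite gf in ge Pg *; apply: one.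
case/andP=> fh hp lp; have he : h \in block e.
  by rewrite -(blockE fe) inE connect1.
have [b' [c' [Pb' Pc' l]]] := two f h fe fh.
apply: linked_trans (one f b b' fe Pf Pb') _; apply: linked_trans l _.
exact: IHp he _ Pc' hp lp.
Qed.

End Blocks.

(** * Blocks are the biconnected components *)

Section Components.
Variable G : mgraph.
Hypotheses (cG : graph_connected G) (nbG : no_bridges G).
Implicit Types (S : subgraph G) (e f g : edge G) (u v w : vert G).

Lemma tree_avoiding e : exists2 T, tree T & e \notin T.
Proof.
have [v _] := graph_vert cG; have := nbG e; rewrite /bridge negbK => se.
have [T TE tT] := tree_in v se; exists T => //.
by apply/negP => /(subsetP TE); rewrite !inE eqxx.
Qed.

Lemma exchangeable_exists e : exists U, exchangeable U e.
Proof.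
have [T tT eT] := tree_avoiding e; exists (e |: T).
rewrite /exchangeable !inE eqxx /=.
suff -> : (e |: T) :\ e = T by [].
by apply/setP => h; rewrite !inE; case: eqVneq => // ->; rewrite (negPf eT).
Qed.

Lemma block_bypass e : linked [set f in block e | f != e] (src e) (tgt e).
Proof.
have [U /exchange_cycle] := exchangeable_exists e; apply: linked_sub.
by apply/subsetP => f; rewrite !inE andbC => /andP[/neighbours_block]; rewrite inE => ->.
Qed.

Lemma linked_graph_of S (A : {set edge (graph_of S)}) (B : {set edge G})
    (u v : vert (graph_of S)) :
  (forall e : edge (graph_of S), e \in A -> val e \in B) ->
  linked A u v -> linked B (val u) (val v).
Proof.
move=> AB /(@linked_inv _ _ (fun w : vert (graph_of S) => linked B (val u) (val w))) <-.
  exact: linked0.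
move=> e' /AB eB; apply: (same_connect_r (@linked_sym _ B)).
exact: (linked_ends false true eB).
Qed.

Lemma graph_of_linked S (A : {set edge (graph_of S)}) (B : {set edge G})
    (u v : vert (graph_of S)) :
  (forall e, e \in B -> exists2 e' : edge (graph_of S), e' \in A & val e' = e) ->
  linked B (val u) (val v) -> linked A u v.
Proof.
move=> BA; pose P w := [exists w' : vert (graph_of S), (val w' == w) && linked A u w'].
move=> /(@linked_inv _ _ P) h.
suff /existsP[w /andP[/eqP/val_inj->//]] : P (val v).
rewrite -h; first by apply/existsP; exists u; rewrite eqxx linked0.
move=> e /BA[e' eA <-]; apply/existsP/existsP => -[w /andP[/eqP we uw]].
  exists (tgt e'); rewrite eqxx; apply: linked_trans uw _.
  have -> : w = src e' by apply: val_inj.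
  exact: (linked_ends false true eA).
exists (src e'); rewrite eqxx; apply: linked_trans uw _.
have -> : w = tgt e' by apply: val_inj.
exact: (linked_ends true false eA).
Qed.

Lemma touches_graph_of S (e : edge (graph_of S)) (v : vert (graph_of S)) :
  touches e v = touches (val e) (val v).
Proof. by rewrite /touches -!val_eqE. Qed.

Lemma block_biconnected e : biconnected (graph_of (block_sub e)).
Proof.
set S := block_sub e.
have edgeS f : f \in block e -> exists f' : edge (graph_of S), val f' = f.
  by move=> fe; exists (Sub f fe); rewrite SubK.
have linkS (A : {set edge G}) (A' : {set edge (graph_of S)})
    (P : pred (vert G)) (u v : vert (graph_of S)) :
    (forall f b c, f \in block e -> P (edge_end f b) -> P (edge_end f c) ->
      linked [set f in block e | f \in A] (edge_end f b) (edge_end f c)) ->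
    (forall f g, f \in block e -> neighbouring f g -> exists b c,
      [/\ P (edge_end f b), P (edge_end g c)
        & linked [set f in block e | f \in A] (edge_end f b) (edge_end g c)]) ->
    (forall f : edge (graph_of S), val f \in A -> f \in A') ->
    P (val u) -> P (val v) -> linked A' u v.
  move=> one two AA' Pu Pv.
  apply: graph_of_linked (block_ends_linked one two (valP u) (valP v) Pu Pv).
  move=> f; rewrite inE => /andP[fe fA]; have [f' f'f] := edgeS f fe.
  by exists f' => //; apply: AA'; rewrite f'f.
have cS : graph_connected (graph_of S).
  apply/andP; split.
    apply/card_gt0P; have srcS : src e \in block_verts e.
      by have /forall_inP/(_ _ (block_id e))/andP[] := block_closed e.
    by exists (Sub (src e) srcS).
  apply/spanningP => u v; apply: (linkS setT _ predT) => // [f b c fe _ _|f g fe fg].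
  - by apply: linked_ends; rewrite in_set fe in_setT.
  - have /shareP[b [c bc]] := neighbouring_share fg.
    by exists b, c; rewrite bc linked0.
have [le|ne] := eqVneq (src e) (tgt e).
  have be := block_loop le.
  have vE (v : vert (graph_of S)) : val v = src e.
    have := valP v; rewrite inE be => /exists_inP[f /set1P->].
    by rewrite /touches -le orbb => /eqP.
  have [/card_gt0P[v _] _] := andP cS; apply: (biconnected_point (v := v)).
    by move=> u; apply: val_inj; rewrite !vE.
  move=> f g; apply: val_inj.
  have fe : val f \in block e := valP f; have ge : val g \in block e := valP g.
  by move: fe ge; rewrite be => /set1P-> /set1P->.
apply: biconnected_crit => //; last first.
- move=> f; rewrite -val_eqE; exact: block_loopless ne (valP f).
- move=> f u v.
  apply: (linkS [set~ val f] _ predT) => //.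
  + move=> g b c ge _ _; have [gf|gf] := eqVneq g (val f); last first.
      by apply: linked_ends; rewrite in_set ge in_setC1.
    have ends : linked [set h in block e | h \in [set~ val f]] (src g) (tgt g).
      rewrite gf; apply: linked_sub (block_bypass (val f)).
      apply/subsetP => h; rewrite (blockE (valP f)).
      by rewrite in_set => /andP[hb hf]; rewrite in_set hb in_setC1.
    by case: b c => [] []; rewrite ?linked0 //= linkedC.
  + move=> g h ge gh; have /shareP[b [c bc]] := neighbouring_share gh.
    by exists b, c; rewrite bc linked0.
  + by move=> g; rewrite !inE.
- move=> v u w uv wv.
  apply: (linkS (avoiding (val v)) _ [pred x | x != val v]) => //.
  + move=> f b c fe /= fb fc; have [->|bc] := eqVneq b c; first exact: linked0.
    apply: linked_ends; rewrite in_set fe in_set; apply/touchesP => -[d fd].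
    by case: b c d fb fc bc fd => [] [] [] //= + + _ fd; rewrite -?fd ?eqxx.
  + move=> f g fe fg; have /shareP[b [c bc]] := neighbouring_share fg.
    have nl h : h \in block e -> src h != tgt h by apply: block_loopless.
    have ge : g \in block e.
      by rewrite -(blockE fe) inE connect1.
    have other h d : h \in block e -> edge_end h d = val v -> edge_end h (~~ d) != val v.
      by move=> /nl hl <-; case: d; rewrite //= eq_sym.
    have [fv|fv] := eqVneq (edge_end f b) (val v); last first.
      by exists b, c; rewrite /= -bc fv linked0.
    (* Neighbouring edges which meet at the removed vertex are joined through their opposite ends,
       around the cycle. *)
    exists (~~ b), (~~ c); split; rewrite /= ?other -?bc //.
    have := neighbouring_avoid fg bc; rewrite fv.
    by rewrite (blockE fe); apply: linked_sub; apply/subsetP => h; rewrite !in_set.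
  + by move=> f; rewrite !inE touches_graph_of.
Qed.

Lemma biconnected_neighbouring S f g : biconnected (graph_of S) ->
  f \in sg_edge S -> g \in sg_edge S -> f != g -> share f g -> neighbouring f g.
Proof.
move=> bS fS gS fg /shareP[b [c bc]].
pose f' : edge (graph_of S) := Sub f fS; pose g' : edge (graph_of S) := Sub g gS.
have endE (h : edge (graph_of S)) d : val (edge_end h d) = edge_end (val h) d by case: d.
have fg' : f' != g' by [].
have bc' : edge_end f' b = edge_end g' c by apply: val_inj; rewrite !endE.
have [av dv ad] := biconnected_avoid bS fg' bc'.
have [|||U Ufg] := neighbours_exist cG fg bc.
- by have := av; rewrite -val_eqE /= !endE.
- by have := dv; rewrite -val_eqE /= !endE.
- have := linked_graph_of (B := avoiding (edge_end f b)) _ ad; rewrite !endE; apply.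
  by move=> h; rewrite !inE touches_graph_of endE.
by apply/existsP; exists U.
Qed.

(** An edge of [S] which meets another edge of [S] in the block is neighbouring to it, hence in the
    block as well. Connectedness of [S] spreads this from [e] to the whole of [S]. *)
Lemma biconnected_block S e : biconnected (graph_of S) -> e \in sg_edge S ->
  sg_le S (block_sub e).
Proof.
move=> bS eS.
have SP f : f \in sg_edge S -> forall b, edge_end f b \in sg_vert S.
  by move=> fS; have /forall_inP/(_ f fS)/andP[sS tS] := sg_closed S; case.
have [/andP[_ /spanningP lS] _] := bS.
pose P v := [exists f in sg_edge S, (f \in block e) && touches f v].
have PP v : v \in sg_vert S -> P v.
  move=> vS.
  have := lS (Sub (src e) (SP e eS false)) (Sub v vS).
  move=> /(@linked_inv _ _ (fun w : vert (graph_of S) => P (val w))) /= h.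
  rewrite -h; first by apply/exists_inP; exists e; rewrite ?block_id ?(touches_end e false).
  move=> f _; suff HP b c : P (edge_end (val f) b) -> P (edge_end (val f) c).
    by apply/idP/idP; [apply: (HP false true) | apply: (HP true false)].
  move=> /exists_inP[g gS /andP[ge gb]].
  apply/exists_inP; exists (val f); first exact: valP.
  rewrite touches_end andbT; have [->//|gf] := eqVneq (val f) g.
  rewrite -(blockE ge) inE; apply: connect1.
  apply: (biconnected_neighbouring bS gS (valP f)); first by rewrite eq_sym.
  by apply/shareP; have /touchesP[d gd] := gb; exists d, b.
apply/andP; split; apply/subsetP; [move=> v /PP | move=> f fS].
  case/exists_inP => f _ /andP[fe fv]; rewrite inE.
  by apply/exists_inP; exists f.
have /exists_inP[g gS /andP[ge gf]] := PP _ (SP f fS false).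
rewrite /= -(blockE ge) inE; have [->|gf'] := eqVneq g f; first exact: connect0.
apply: connect1; apply: (biconnected_neighbouring bS gS fS) => //.
by apply/shareP; have /touchesP[d gd] := gf; exists d, false.
Qed.

Lemma sg_le_anti S S' : sg_le S S' -> sg_le S' S -> S = S'.
Proof.
case: S S' => [V E cE] [V' E' cE'] /andP[/= VV EE] /andP[/= VV' EE'].
have eV : V = V' by apply/eqP; rewrite eqEsubset VV.
have eE : E = E' by apply/eqP; rewrite eqEsubset EE.
by subst V' E'; rewrite (bool_irrelevance cE cE').
Qed.

Lemma block_maximal e S : biconnected (graph_of S) -> sg_le (block_sub e) S ->
  sg_le S (block_sub e).
Proof.
by move=> bS /andP[_ /subsetP eS]; apply: biconnected_block => //; apply/eS/block_id.
Qed.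

Definition block_component e : bicomponent G :=
  Bicomponent (block_biconnected e) (@block_maximal e).

Lemma bicomponent_block (C : bicomponent G) e : e \in sg_edge C -> bc_sub C = block_sub e.
Proof.
move=> eC; have le := biconnected_block (bc_biconnected C) eC.
by apply: sg_le_anti => //; apply: bc_maximal (block_biconnected e) le.
Qed.

Lemma connected_touches : (0 < #|edge G|)%N -> forall v, exists e, touches e v.
Proof.
case/card_gt0P=> e0 _ v; have /spanningP/(_ v (src e0)) := graph_spanning cG.
have [->|ne] := eqVneq v (src e0); first by exists e0; rewrite (touches_end e0 false).
move=> l; have vW : v \in [set v] by rewrite inE.
have sW : src e0 \notin [set v] by rewrite inE eq_sym.
have [e _ [b [/set1P <- _]]] := leaving_edge l vW sW.
by exists e; apply: touches_end.
Qed.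

(** Without edges a component would be a single vertex, properly contained in the block of an edge
    at this vertex, against maximality. *)
Lemma bicomponent_edge (C : bicomponent G) : (0 < #|edge G|)%N ->
  exists e, e \in sg_edge C.
Proof.
move=> E0; have [/andP[/card_gt0P[v _] /spanningP lC] _] := bc_biconnected C.
have [e ev] := connected_touches E0 (val v).
have [f fC|NC] := pickP (mem (sg_edge C)); first by exists f.
suff /(bc_maximal (block_biconnected e))/andP[_ /subsetP/(_ e)] : sg_le C (block_sub e).
  by rewrite block_id => /(_ isT) eC; exists e.
apply/andP; split; apply/subsetP; last by move=> f fC; have := NC f; rewrite /= fC.
move=> u uC; have := lC v (Sub u uC) => /(@linked_inv _ _ (pred1 v)) /=.
rewrite eqxx => h; suff <- : val v = u.
  by rewrite inE; apply/exists_inP; exists e; rewrite ?block_id.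
suff /eqP <- : Sub u uC == v by rewrite SubK.
by rewrite -h // => f _; have := NC (val f); rewrite /= (valP f).
Qed.

End Components.

Local Open Scope ring_scope.

(** * Quasistable divisors and orientations *)

Section SubdivisionSums.
Variables (G : mgraph) (n : edge G -> nat) (M : nmodType).

Lemma sum_sub_vert (F : vert (subdivision n) -> M) :
  \sum_x F x = \sum_v F (inl v) + \sum_e \sum_(i < n e) F (sub_point n e i.+1).
Proof.
rewrite big_sumType; congr (_ + _).
rewrite (eq_bigr (fun e => \sum_(i < n e) F (inr (Tagged (fun e => 'I_(n e)) i)))).
  rewrite (sig_big_dep _ _ (fun e i => F (inr (Tagged (fun e => 'I_(n e)) i)))).
  by apply: eq_bigr => -[].
move=> e _; apply: eq_bigr => i _; rewrite (sub_point_in (ltn_ord i)).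
by congr (F (inr (Tagged _ _))); apply: val_inj.
Qed.

Lemma sum_sub_edge (F : edge (subdivision n) -> M) :
  \sum_a F a = \sum_e \sum_(i < (n e).+1) F (Tagged (fun e => 'I_(n e).+1) i).
Proof. by rewrite sig_big_dep; apply: eq_bigr => -[]. Qed.

End SubdivisionSums.

Lemma sum_ord_bool (b : bool) (M : nmodType) (F : nat -> M) :
  \sum_(i < b) F i = if b then F 0%N else 0.
Proof. by case: b; rewrite ?big_ord_recl big_ord0 ?addr0. Qed.

Lemma sum_ord_bool1 (b : bool) (M : nmodType) (F : nat -> M) :
  \sum_(i < b.+1) F i = F 0%N + if b then F 1%N else 0.
Proof. by case: b; rewrite !big_ord_recl big_ord0 ?addr0. Qed.

Section Stability.
Variable G : mgraph.
Implicit Types (p q : pseudo_divisor G) (e f : edge G) (v w : vert G).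

Definition nsub p (e : edge G) : nat := e \in pd_set p.

(** The exceptional vertex of [e] if [e] is in [pd_set p], and [tgt e] by default for the other
    edges. *)
Definition mid p e : vert (insert_verts (pd_set p)) := sub_point (nsub p) e 1.

Lemma sum_pd p (M : nmodType) (F : vert (insert_verts (pd_set p)) -> M) :
  \sum_x F x = \sum_v F (inl v) + \sum_(e in pd_set p) F (mid p e).
Proof.
rewrite sum_sub_vert; congr (_ + _); rewrite [RHS]big_mkcond.
by apply: eq_bigr => e _; rewrite (sum_ord_bool _ (fun i => F (sub_point _ e i.+1))).
Qed.

Lemma pd_div_mid p e : e \in pd_set p -> pd_div p (mid p e) = 1.
Proof.
move=> ep; have n0 : (0 < nsub p e)%N by rewrite /nsub ep.
rewrite /mid (sub_point_in n0) /pd_div; case: p ep n0 => d /= dP ep n0.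
exact/eqP/(forallP dP).
Qed.

Lemma polarization_mid p e : e \in pd_set p -> polarization (mid p e) = 0.
Proof.
by move=> ep; have n0 : (0 < nsub p e)%N; rewrite /nsub ?ep // /mid (sub_point_in n0).
Qed.

Lemma degree_pd p : \sum_x pd_div p x = \sum_v at_vert p v + #|pd_set p|%:Z.
Proof.
rewrite sum_pd; congr (_ + _).
rewrite (eq_bigr (fun=> 1)) => [|e ep]; last exact: pd_div_mid.
by rewrite sumr_const natz.
Qed.

Lemma sum_valence (M : nmodType) (P : pred (vert G)) (a : M) :
  \sum_(v | P v) a *+ valence v = \sum_e (a *+ P (src e) + a *+ P (tgt e)).
Proof.
have E (h : edge G -> vert G) :
    \sum_(v | P v) a *+ #|[set e | h e == v]| = \sum_e a *+ P (h e).
  rewrite (eq_bigr (fun v => \sum_(e | h e == v) a)); last first.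
    by move=> v _; rewrite sumr_const cardsE.
  rewrite (exchange_big_dep predT) //=; apply: eq_bigr => e _.
  rewrite (eq_bigl (fun v => (v == h e) && P (h e))); last first.
    by move=> v; rewrite andbC eq_sym; case: eqVneq => // ->.
  case: (P (h e)); last by rewrite big_pred0 // => v; rewrite andbF.
  by rewrite (eq_bigl _ _ (fun v => andbT _)) big_pred1_eq.
rewrite big_split /= -!E -big_split /=; apply: eq_bigr => v _.
by rewrite /valence mulrnDr.
Qed.

(** What [e] contributes once the half-integers are collected: the degree 1 of an exceptional vertex
    in [W], minus one half for each end in [W] (from the valences), plus half the number of cut
    edges on [e]. *)
Definition edge_defect p (W : {set vert (insert_verts (pd_set p))}) e : int :=
  if e \in pd_set p
  then if mid p e \in W then 2 - (inl (src e) \in W)%:Z - (inl (tgt e) \in W)%:Z else 0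
  else - ((inl (src e) \in W) && (inl (tgt e) \in W))%:Z.

Lemma stabilityE p (W : {set vert (insert_verts (pd_set p))}) :
  stability W = (\sum_(v | inl v \in W) (at_vert p v + 1) + \sum_e edge_defect W e)%:~R.
Proof.
pose s e : rat := (inl (src e) \in W)%:R; pose t e : rat := (inl (tgt e) \in W)%:R.
pose m e : rat := (mid p e \in W)%:R.
have D : \sum_(x in W) (pd_div p x)%:~R =
    \sum_(v | inl v \in W) (at_vert p v)%:~R + \sum_(e in pd_set p) m e :> rat.
  rewrite big_mkcond sum_pd -big_mkcond /=; congr (_ + _).
  by apply: eq_bigr => e ep; rewrite pd_div_mid // /m; case: ifP.
have P : \sum_(x in W) polarization x =
    \sum_(v | inl v \in W) (-1) + \sum_e (s e + t e) / 2 :> rat.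
  rewrite big_mkcond sum_pd -big_mkcond /= [X in _ + X]big1 ?addr0 => [|e ep]; last first.
    by rewrite polarization_mid // if_same.
  rewrite big_split /=; congr (_ + _).
  rewrite (eq_bigr (fun v => (1 / 2) *+ valence v)) => [|v _].
    rewrite (sum_valence (fun v => inl v \in W)); apply: eq_bigr => e _.
    by rewrite /s /t; case: (inl _ \in W) (inl _ \in W) => [] [] /=; lra.
  by rewrite -mulr_natr; lra.
have C : (cut_size W)%:R = \sum_e (if e \in pd_set p
    then ((inl (src e) \in W) != (mid p e \in W))%:R +
         ((mid p e \in W) != (inl (tgt e) \in W))%:R
    else ((inl (src e) \in W) != (inl (tgt e) \in W))%:R) :> rat.
  rewrite /cut_size -sum1_card natr_sum big_mkcond sum_sub_edge.
  apply: eq_bigr => e _; pose c k : rat :=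
    ((sub_point (nsub p) e k \in W) != (sub_point (nsub p) e k.+1 \in W))%:R.
  rewrite (eq_bigr (fun i : 'I_(nsub p e).+1 => c i)) => [|i _]; last first.
    by rewrite inE /c; case: (_ != _).
  rewrite (sum_ord_bool1 (e \in pd_set p) c) /c.
  rewrite -[sub_point _ _ 0]/(inl (src e)) -/(mid p e).
  have [ep|ep] := boolP (e \in pd_set p).
    have -> : sub_point (nsub p) e 2 = inl (tgt e).
      by rewrite -(sub_point_last (nsub p)) /nsub ep.
    by [].
  have -> : mid p e = inl (tgt e).
    by rewrite /mid -(sub_point_last (nsub p)) /nsub (negPf ep).
  by rewrite addr0.
rewrite /stability D P C rmorphD !rmorph_sum /= big_mkcond [in RHS]big_mkcond /=.
rewrite [X in _ + X - _]big_mkcond [X in _ - (X + _)]big_mkcond /=.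
rewrite opprD addrACA -[LHS]addrA mulr_suml -!sumrN -!big_split /=; congr (_ + _).
  by apply: eq_bigr => v _; case: ifP => _; rewrite ?rmorphD /=; lra.
apply: eq_bigr => e _; rewrite /edge_defect /m /s /t; case: (e \in pd_set p).
  by case: (mid p e \in W); case: (inl _ \in W); case: (inl _ \in W) => /=; lra.
by case: (inl _ \in W); case: (inl _ \in W) => /=; lra.
Qed.

End Stability.

Section Orientations.
Variable G : mgraph.
Implicit Types (p q : pseudo_divisor G) (e f : edge G) (v w : vert G).
Implicit Types (S T : {set edge G}) (O : edge G -> bool).

Lemma pd_eq p q : pd_set p = pd_set q -> at_vert p =1 at_vert q -> p = q.
Proof.
case: p q => -[Sp dp] pP [[Sq dq] qP]; rewrite /at_vert /pd_set /pd_div /=.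
move=> eS; subst Sq => eD; apply: val_inj => /=; congr (existT _ _ _).
apply/ffunP => -[v|a]; first exact: eD.
by rewrite (eqP (forallP pP a)) (eqP (forallP qP a)).
Qed.

Lemma pd_ge_card p q : pd_ge p q -> q <> p -> (#|pd_set q| < #|pd_set p|)%N.
Proof.
move=> [phi [qp _ qE]] neq; rewrite ltn_neqAle subset_leq_card // andbT.
apply/eqP => cE; apply: neq; apply: pd_eq.
  by apply/eqP; rewrite eqEcard qp cE leqnn.
have pq : pd_set p :\: pd_set q = set0.
  by apply/eqP; rewrite setD_eq0; have := subset_leqif_card qp => -[_]; rewrite cE eqxx => <-.
move=> v; rewrite qE pq (_ : [set e in set0 | _] = set0) ?cards0 ?addr0 //.
by apply/setP => e; rewrite !inE.
Qed.

Section Quasistable.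
Variables (v0 : vert G) (p : pseudo_divisor G).
Hypothesis qs : quasistable v0 p.

Definition surplus (V : {set vert G}) : int :=
  \sum_(v in V) (at_vert p v + 1) -
  \sum_(e | e \notin pd_set p) ((src e \in V) && (tgt e \in V))%:Z.

Lemma stability_surplus (V : {set vert G}) :
  stability [set x : vert (insert_verts (pd_set p)) | if x is inl v then v \in V else false]
    = (surplus V)%:~R.
Proof.
rewrite stabilityE; congr (_%:~R); rewrite /surplus; congr (_ + _).
  by apply: eq_bigl => v; rewrite inE.
rewrite -sumrN [RHS]big_mkcond; apply: eq_bigr => e _; rewrite /edge_defect !inE.
case: ifP => // ep; have n0 : (0 < nsub p e)%N by rewrite /nsub ep.
by rewrite /mid (sub_point_in n0).
Qed.

Lemma surplus_ge0 (V : {set vert G}) : V != set0 ->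
  (0 <= surplus V) && ((v0 \notin V) ==> (0 < surplus V)).
Proof.
case/set0Pn => v vV; have /andP[_ /forallP stab] := qs.
have := stab [set x | if x is inl v then v \in V else false].
rewrite stability_surplus ler0z ltr0z inE => /implyP; apply.
by apply/set0Pn; exists (inl v); rewrite inE.
Qed.

Lemma sum_at_vert : \sum_v at_vert p v = genus G - 1 - #|pd_set p|%:Z.
Proof. by have /andP[/eqP] := qs; rewrite degree_pd => <- _; rewrite addrK. Qed.

Lemma card_pd_setC : #|~: pd_set p|%:Z = #|edge G|%:Z - #|pd_set p|%:Z.
Proof. by rewrite -(cardsC (pd_set p)) PoszD; lia. Qed.

(** No edge outside [pd_set p] leaves the component [V] of [v0], so the surpluses of [V] and of its
    complement add up to that of the whole graph, which is 0 because the degree is [genus G - 1].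
    But the first is nonnegative, and the second would be positive as the complement avoids [v0]. *)
Lemma quasistable_spanning : spanning (~: pd_set p).
Proof.
set A := ~: pd_set p; pose V := [set w | linked A v0 w].
have VT : ~: V = set0.
  apply/eqP/negPn/negP => V0.
  have v0V : v0 \in V by rewrite inE linked0.
  have /andP[V1 _] : (0 <= surplus V) && ((v0 \notin V) ==> (0 < surplus V)).
    by apply: surplus_ge0; apply/set0Pn; exists v0.
  have /andP[_ /implyP/(_ _) V2] := surplus_ge0 V0.
  have {}V2 : 0 < surplus (~: V) by apply: V2; rewrite inE v0V.
  suff : surplus V + surplus (~: V) = 0 by lia.
  have -> : surplus V + surplus (~: V) =
      \sum_v (at_vert p v + 1) - \sum_(e | e \notin pd_set p) 1.
    rewrite [X in X - _](bigID (mem V)) /= /surplus addrACA -opprD -big_split /=.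
    congr (_ + _ - _).
      by apply: eq_bigl => v; rewrite inE.
    apply: eq_bigr => e ep.
    rewrite !in_setC; have -> : (tgt e \in V) = (src e \in V).
      rewrite !inE; apply: (same_connect_r (@linked_sym _ A)).
      by apply: (linked_ends true false); rewrite inE.
    by rewrite !andbb; case: (src e \in V).
  have -> : \sum_(e | e \notin pd_set p) 1 = #|A|%:Z :> int.
    by rewrite (eq_bigl (mem A)) => [|e]; rewrite ?sumr_const ?natz //= inE.
  rewrite big_split /= sum_at_vert sumr_const card_pd_setC /genus natz.
  have -> : #|(fun=> true) : pred (vert G)| = #|vert G| by apply: eq_card.
  by lia.
apply/spanningP => u w; have all x : linked A v0 x.
  by have := in_set0 x; rewrite -VT !inE => /negbFE.
by apply: linked_trans (all w); rewrite linkedC.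
Qed.

Lemma quasistable_card : #|pd_set p|%:Z <= genus G.
Proof.
have V0 : (0 < #|vert G|)%N by apply/card_gt0P; exists v0.
have := spanning_card V0 quasistable_spanning; have := card_pd_setC.
by rewrite /genus; lia.
Qed.

Hypothesis top : #|pd_set p|%:Z = genus G.

Lemma quasistable_tree : tree (~: pd_set p).
Proof.
rewrite /tree quasistable_spanning /=; have := card_pd_setC.
rewrite top /genus => h; suff -> : #|~: pd_set p|.+1 = #|vert G| by rewrite eqxx.
by lia.
Qed.

(** The stability of single vertices gives one inequality at each vertex; as the values at the
    vertices of the graph sum to -1, all these inequalities are equalities. *)
Lemma quasistable_top v : at_vert p v = - (v == v0)%:Z.
Proof.
have ge w : - (w == v0)%:Z <= at_vert p w.
  have /andP[] : (0 <= surplus [set w]) && ((v0 \notin [set w]) ==> (0 < surplus [set w])).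
    by apply: surplus_ge0; apply/set0Pn; exists w; rewrite inE.
  rewrite /surplus big_set1 inE [v0 == w]eq_sym; set s := \sum_(e | _) _.
  have s0 : 0 <= s by apply: sumr_ge0.
  by case: eqVneq => _ /=; lia.
suff /psumr_eq0P h : \sum_w (at_vert p w + (w == v0)%:Z) = 0.
  by apply/eqP; rewrite -addr_eq0 h // => w _; have := ge w; lia.
rewrite big_split /= sum_at_vert top (bigD1 v0) //= eqxx big1 => [|w /negPf->] //.
by lia.
Qed.

End Quasistable.

Section Oriented.
Variables (v0 : vert G) (T S : {set edge G}) (O : edge G -> bool).

(** The number of incoming edges minus 1, when the edges of [T] are oriented away from [v0]: these
    enter each vertex once, except [v0], so that together with the shift by 1 they leave the term
    [- (v == v0)]. *)
Definition oriented_at v : int :=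
  \sum_(e | (e \notin T) && (e \notin S)) (edge_end e (O e) == v)%:Z - (v == v0)%:Z.

Definition oriented_data : pseudo_divisor_data G :=
  existT (fun ES : {set edge G} => {ffun vert (insert_verts ES) -> int}) S
    [ffun x => if x is inl v then oriented_at v else 1].

Lemma oriented_exceptional : [forall x, tagged oriented_data (inr x) == 1].
Proof. by apply/forallP => x; rewrite /= ffunE. Qed.

Definition oriented_pd : pseudo_divisor G := PseudoDivisor oriented_exceptional.

Lemma oriented_set : pd_set oriented_pd = S.
Proof. by []. Qed.

Lemma oriented_in e : (e \in pd_set oriented_pd) = (e \in S).
Proof. by []. Qed.

Lemma oriented_vert v : at_vert oriented_pd v = oriented_at v.
Proof. by rewrite /at_vert /pd_div /= ffunE. Qed.

Hypotheses (tT : tree T) (ST : S \subset ~: T).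

(** An oriented edge with both ends in [W] points to a vertex of [W], which pays for it. So the
    stability is at least the number of ordinary vertices of [W], minus 1 if [v0] is one of them,
    minus the number of edges of [T] between them; these edges form a forest. *)
Lemma oriented_quasistable : quasistable v0 oriented_pd.
Proof.
have TS e : e \in S -> e \notin T by move=> /(subsetP ST); rewrite inE.
have sumE (P : pred (vert G)) : \sum_(v | P v) oriented_at v =
    \sum_(e | (e \notin T) && (e \notin S)) (P (edge_end e (O e)))%:Z - (P v0)%:Z.
  rewrite sumrB exchange_big /=; congr (_ - _).
    apply: eq_bigr => e _; rewrite big_mkcond (bigD1 (edge_end e (O e))) //= eqxx big1.
      by rewrite addr0; case: ifP.
    by move=> v ve; rewrite eq_sym (negPf ve) if_same.
  rewrite big_mkcond (bigD1 v0) //= eqxx big1; first by rewrite addr0; case: ifP.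
  by move=> v /negPf->; rewrite if_same.
apply/andP; split.
  rewrite degree_pd (eq_bigr oriented_at) => [|v _]; last exact: oriented_vert.
  rewrite (sumE predT) /= (eq_bigl (mem (~: (T :|: S)))) => [|e]; last first.
    by rewrite /= in_setC in_setU negb_or.
  rewrite sumr_const natz oriented_set.
  have := cardsC (T :|: S); rewrite cardsU (_ : T :&: S = set0) ?cards0; last first.
    by apply/setP => e; rewrite !inE; apply/negP => /andP[eT /TS]; rewrite eT.
  rewrite /genus -(tree_card tT) => h; rewrite -subr_eq0.
  set x := (X in X == 0); have -> : x = 0 by rewrite /x; lia.
  exact: eqxx.
apply/forall_inP => W W0; rewrite stabilityE ler0z ltr0z.
pose V := [set v | inl v \in W].
have [V0|V0] := eqVneq V set0.
  (* [W] has exceptional vertices only, and each of them contributes 2. *)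
  suff pos : 0 < \sum_(v | inl v \in W) (at_vert oriented_pd v + 1) + \sum_e edge_defect W e.
    by rewrite (ltW pos) pos implybT.
  have NV v : (inl v \in W) = false by have := in_set0 v; rewrite -V0 inE.
  rewrite big_pred0 // add0r.
  have dE e : edge_defect W e = if (e \in S) && (mid oriented_pd e \in W) then 2 else 0.
    by rewrite /edge_defect !NV oriented_in; case: (e \in S).
  have /set0Pn[[v|[e i]] xW] := W0; first by rewrite NV in xW.
  have eS : e \in S by case: (e \in S) i {xW} => // -[].
  have eW : mid oriented_pd e \in W.
    have n0 : (0 < nsub oriented_pd e)%N by rewrite /nsub oriented_in eS.
    rewrite /mid (sub_point_in n0); congr (_ \in W): xW; congr (inr (Tagged _ _)).
    by apply: val_inj; case: i => i /=; rewrite eS => i0; move: i0; case: i.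
  rewrite (bigD1 e) //= dE eS eW; apply: ltr_pwDl => //.
  by apply: sumr_ge0 => f _; rewrite dE; case: ifP.
have := tree_forest tT V0; set I := [set e in T | _] => forest.
have le : #|V|%:Z - (inl v0 \in W)%:Z - #|I|%:Z <=
    \sum_(v | inl v \in W) (at_vert oriented_pd v + 1) + \sum_e edge_defect W e.
  rewrite big_split /= (eq_bigr oriented_at) => [|v _]; last exact: oriented_vert.
  have -> : \sum_(v | inl v \in W) 1 = #|V|%:Z.
    by rewrite (eq_bigl (mem V)) => [|v]; rewrite ?sumr_const ?natz //= inE.
  rewrite (sumE (fun v => inl v \in W)).
  have key (a b x y z : int) : - x <= a + b -> y - z - x <= a - z + y + b by lia.
  apply: key.
  have -> : - #|I|%:Z = \sum_e - (e \in I)%:Z.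
    by rewrite sumrN -sum1_card big_mkcond /= -natz natr_sum; congr (- _);
      apply: eq_bigr => e _; case: ifP.
  rewrite [X in _ <= X + _]big_mkcond -big_split /=; apply: ler_sum => e _.
  rewrite /edge_defect oriented_in !inE.
  have [eS|eS] := boolP (e \in S).
    rewrite (negPf (TS e eS)) /= add0r; case: ifP => // _.
    by case: (inl (src e) \in W); case: (inl (tgt e) \in W).
  case: (e \in T) => /=; first by case: (inl (src e) \in W); case: (inl (tgt e) \in W).
  by case: (O e) => /=; case: (inl (src e) \in W); case: (inl (tgt e) \in W).
apply/andP; split; first by apply: le_trans le; lia.
by apply/implyP => v0W; apply: lt_le_trans le; rewrite (negPf v0W); lia.
Qed.

Definition oriented : QD v0 := QDiv oriented_quasistable.

End Oriented.

Lemma oriented_ge v0 T S S' O : S' \subset S -> S \subset ~: T ->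
  specializes (fun e => edge_end e (O e)) (oriented_pd v0 T S O) (oriented_pd v0 T S' O).
Proof.
move=> SS ST; split=> // [e _|v]; first by case: (O e); [right | left].
rewrite !oriented_vert /oriented_at !oriented_set addrAC; congr (_ - _).
rewrite -sum1_card -[X in _ + X]natz natr_sum [LHS]big_mkcond.
rewrite [X in _ = X + _]big_mkcond [X in _ = _ + X]big_mkcond -big_split /=.
apply: eq_bigr => e _; rewrite !inE.
have [eS'|eS'] := boolP (e \in S').
  by rewrite (subsetP SS) // andbF.
have [eS|eS] := boolP (e \in S); rewrite /= ?andbF ?andbT ?addr0 //.
by have := subsetP ST e eS; rewrite inE => ->; rewrite add0r; case: eqP.
Qed.

End Orientations.

(** * Isomorphisms of complexes *)

Section Ranks.
Variables (G G' : mgraph) (v0 : vert G) (v0' : vert G').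
Variable sigma : QD v0 -> QD v0'.
Hypotheses (sigma_inj : injective sigma)
  (sigma_mono : forall p q : QD v0, pd_ge p q -> pd_ge (sigma p) (sigma q)).

Lemma oriented_pd_eq (T S : {set edge G}) (O O' : edge G -> bool) :
  (forall e, e \notin T -> e \notin S -> O e = O' e) ->
  oriented_pd v0 T S O = oriented_pd v0 T S O'.
Proof.
move=> OO; apply: pd_eq => // v; rewrite !oriented_vert; congr (_ - _).
by apply: eq_bigr => e /andP[eT eS]; rewrite OO.
Qed.

Variables (T : {set edge G}) (tT : tree T) (O : edge G -> bool).

(** The edges of [S :\: S'] are frozen one at a time. As [sigma] is injective and monotone, each
    proper face is sent to a proper face, which has smaller dimension. *)
Lemma oriented_rank (S S' : {set edge G})
    (SS : S' \subset S) (ST : S \subset ~: T) (ST' : S' \subset ~: T) :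
  (#|pd_set (sigma (oriented v0 O tT ST'))| + #|S :\: S'| <=
   #|pd_set (sigma (oriented v0 O tT ST))|)%N.
Proof.
have [n] := ubnP #|S :\: S'|; elim: n S ST SS => // n IHn S ST SS ltn.
have [SE|/set0Pn[e eSS]] := eqVneq (S :\: S') set0.
  have SE' : S = S' by apply/eqP; rewrite eqEsubset SS andbT -setD_eq0 SE.
  by rewrite SE cards0 addn0; subst S'; rewrite (bool_irrelevance ST ST').
move: (eSS); rewrite inE => /andP[eS' eS].
have SeT : S :\ e \subset ~: T by apply: subset_trans ST; apply: subsetDl.
have SSe : S' \subset S :\ e by rewrite subsetD1 SS.
have De : (S :\ e) :\: S' = (S :\: S') :\ e.
  by apply/setP => f; rewrite !inE andbCA.
have := cardsD1 e (S :\: S'); rewrite eSS add1n -De => cD.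
rewrite cD ltnS in ltn; have := IHn _ SeT SSe ltn.
rewrite cD addnS => /leq_ltn_trans; apply; apply: pd_ge_card.
  apply: sigma_mono; exists (fun e => edge_end e (O e)).
  by apply: oriented_ge; rewrite ?subsetDl.
move=> /val_inj/sigma_inj/(congr1 (fun q : QD v0 => pd_set q)) /setP/(_ e).
by rewrite !inE eqxx eS.
Qed.

End Ranks.

(** * Images of the corners and sides of the boxes *)

Section Corners.
Variables (R : realFieldType) (G G' : mgraph) (v0 : vert G) (v0' : vert G').
Variables (l : edge G -> R) (l' : edge G' -> R).
Hypotheses (l_gt0 : forall e, 0 < l e) (l'_gt0 : forall e, 0 < l' e).
Hypotheses (cG : graph_connected G) (cG' : graph_connected G').
Hypotheses (nbG : no_bridges G) (nbG' : no_bridges G').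

Definition in_box H (k : edge H -> R) (p : pseudo_divisor H) (x : edge H -> R) : Prop :=
  forall e, e \in pd_set p -> 0 <= x e <= k e.

(* The coordinates in the open interval and the divisor which remains when the
   other coordinates are moved to an end-vertex: these two functions determine
   the image of x in the complex. *)
Definition inner_coord H (k : edge H -> R) (p : pseudo_divisor H) (x : edge H -> R) e : R :=
  if (e \in pd_set p) && (0 < x e < k e) then x e else 0.

Definition face_div H (k : edge H -> R) (p : pseudo_divisor H) (x : edge H -> R) v : int :=
  at_vert p v + \sum_(e in pd_set p)
    ((x e == 0) && (src e == v) || (x e == k e) && (tgt e == v))%:Z.

Definition face_of (p q : pseudo_divisor G) (x y : edge G -> R) : Prop :=
  exists b : edge G -> bool,
    [/\ specializes (fun e => edge_end e (b e)) p q,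
        forall e, e \in pd_set q -> x e = y e
      & forall e, e \in pd_set p -> e \notin pd_set q ->
          x e = if b e then l e else 0].

Variables (sigma : QD v0 -> QD v0') (tau : QD v0' -> QD v0).
(** A point of a cell is given by a function on all the edges, so that cells of different dimensions
    have coordinates of one type; the meaningful values are those on [pd_set]. *)
Variable phi : QD v0 -> (edge G -> R) -> edge G' -> R.
Hypotheses (sigmaK : cancel sigma tau) (tauK : cancel tau sigma).
Hypothesis sigma_mono : forall p q : QD v0, pd_ge p q -> pd_ge (sigma p) (sigma q).
Hypothesis tau_mono : forall p q : QD v0', pd_ge p q -> pd_ge (tau p) (tau q).
Hypothesis phi_box : forall (p : QD v0) x, in_box l p x -> in_box l' (sigma p) (phi p x).
Hypothesis phi_face : forall (p q : QD v0) x y, in_box l p x -> in_box l q y ->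
  face_of p q x y ->
  inner_coord l' (sigma p) (phi p x) =1 inner_coord l' (sigma q) (phi q y) /\
  face_div l' (sigma p) (phi p x) =1 face_div l' (sigma q) (phi q y).
Hypothesis phi_affine : forall (p : QD v0) t x y z,
  in_box l p x -> in_box l p y -> in_box l p z -> 0 <= t <= 1 ->
  (forall e, e \in pd_set p -> z e = (1 - t) * x e + t * y e) ->
  forall e, e \in pd_set (sigma p) -> phi p z e = (1 - t) * phi p x e + t * phi p y e.
Hypothesis phi_dist : forall (p : QD v0) x y, in_box l p x -> in_box l p y ->
  \sum_(e in pd_set (sigma p)) (phi p x e - phi p y e) ^+ 2 =
  \sum_(e in pd_set p) (x e - y e) ^+ 2.

Let sigma_inj : injective sigma := can_inj sigmaK.
Let tau_inj : injective tau := can_inj tauK.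

Lemma card_setC_tree H (T : {set edge H}) : tree T -> #|~: T|%:Z = genus H.
Proof. by move=> tT; rewrite /genus -(cardsC T) -(tree_card tT); lia. Qed.

(** The genus is the dimension of the largest cells. A chain of faces from a vertex to such a cell
    keeps its length under [sigma], and likewise under [tau]. *)
Lemma genus_eq : genus G = genus G'.
Proof.
have [v _] := graph_vert cG; have [T _ tT] := tree_in v (graph_spanning cG).
have [v' _] := graph_vert cG'; have [T' _ tT'] := tree_in v' (graph_spanning cG').
have := oriented_rank sigma_inj sigma_mono tT xpred0 (sub0set _) (subxx _) (sub0set _).
have := oriented_rank tau_inj tau_mono tT' xpred0 (sub0set _) (subxx _) (sub0set _).
rewrite !setD0; set p := tau _; set p' := sigma _ => le le'.
have := quasistable_card (valP (tau (oriented v0' xpred0 tT' (subxx _)))).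
have := quasistable_card (valP (sigma (oriented v0 xpred0 tT (subxx _)))).
by rewrite -(card_setC_tree tT) -(card_setC_tree tT'); rewrite /=; lia.
Qed.

(** No edge remains to be oriented, so [xpred0] is an arbitrary choice. *)
Definition top (T : {set edge G}) (tT : tree T) : QD v0 := oriented v0 xpred0 tT (subxx (~: T)).

(** The lower bound comes from a chain of faces down to a vertex, the upper bound from a chain up to
    the box of [T], whose image has dimension at most the genus. *)
Lemma oriented_card (T S : {set edge G}) O (tT : tree T) (ST : S \subset ~: T) :
  #|pd_set (sigma (oriented v0 O tT ST))| = #|S|.
Proof.
have le := oriented_rank sigma_inj sigma_mono tT O (sub0set S) ST (sub0set _).
have le' := oriented_rank sigma_inj sigma_mono tT O ST (subxx _) ST.
have := quasistable_card (valP (sigma (oriented v0 O tT (subxx _)))).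
rewrite -genus_eq -(card_setC_tree tT) /= => le2.
have := cardsID S (~: T); rewrite (setIidPr ST) => cD.
by rewrite setD0 in le; apply/eqP; rewrite eqn_leq; apply/andP; split; lia.
Qed.

Lemma top_in (T : {set edge G}) (tT : tree T) e : (e \in pd_set (top tT)) = (e \notin T).
Proof. by rewrite -in_setC. Qed.

Lemma top_card (T : {set edge G}) (tT : tree T) : #|pd_set (sigma (top tT))| = #|~: T|.
Proof. exact: oriented_card. Qed.

Lemma sigma_top (T : {set edge G}) (tT : tree T) :
  tree (~: pd_set (sigma (top tT))) /\
  forall v, at_vert (sigma (top tT)) v = - (v == v0')%:Z.
Proof.
have c : #|pd_set (sigma (top tT))|%:Z = genus G'.
  by rewrite top_card -genus_eq card_setC_tree.
split; first exact: quasistable_tree (valP (sigma (top tT))) c.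
exact: quasistable_top (valP (sigma (top tT))) c.
Qed.

Lemma sigma_top_surj (T' : {set edge G'}) : tree T' ->
  exists (T : {set edge G}) (tT : tree T), pd_set (sigma (top tT)) = ~: T'.
Proof.
move=> tT'; pose p' := oriented v0' xpred0 tT' (subxx _); pose p := tau p'.
have c : #|pd_set p|%:Z = genus G.
  have := oriented_rank tau_inj tau_mono tT' xpred0 (sub0set _) (subxx _) (sub0set _).
  rewrite setD0 -/p' -/p; have := quasistable_card (valP p).
  by have := card_setC_tree tT'; rewrite -genus_eq /=; lia.
have tT := quasistable_tree (valP p) c; exists (~: pd_set p), tT.
suff -> : top tT = p by rewrite tauK.
apply: val_inj; apply: pd_eq => [|v]; rewrite /= ?oriented_set ?setCK //.
rewrite oriented_vert (quasistable_top (valP p) c) /oriented_at big_pred0 ?sub0r // => e.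
by rewrite !inE negbK andbN.
Qed.

Definition corner (O : edge G -> bool) e : R := if O e then l e else 0.

Lemma corner_box O p : in_box l p (corner O).
Proof.
by move=> e _; rewrite /corner; case: (O e); rewrite ?lexx ?(ltW (l_gt0 e)).
Qed.

Arguments corner_box : clear implicits.

Definition vertex (T : {set edge G}) (tT : tree T) O : QD v0 := oriented v0 O tT (sub0set _).

Lemma face_oriented (T S : {set edge G}) O (tT : tree T) (ST : S \subset ~: T) x y :
  (forall e, e \notin T -> e \notin S -> x e = corner O e) ->
  (forall e, e \in S -> x e = y e) ->
  face_of (top tT) (oriented v0 O tT ST) x y.
Proof.
move=> xO xy; exists O; split=> [|e|e].
- have -> : qd (top tT) = oriented_pd v0 T (~: T) O.
    by apply: oriented_pd_eq => e eT; rewrite in_setC eT.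
  exact: oriented_ge.
- by rewrite oriented_in; apply: xy.
- by rewrite top_in; apply: xO.
Qed.

Section Tree.
Variables (T : {set edge G}) (tT : tree T).
Notation P' := (pd_set (sigma (top tT))).

Lemma vertex_set O : pd_set (sigma (vertex tT O)) = set0.
Proof. by apply/eqP; rewrite -cards_eq0 oriented_card cards0. Qed.

Definition image O := phi (top tT) (corner O).

Lemma vertex_face O : face_of (top tT) (vertex tT O) (corner O) (corner O).
Proof. exact: face_oriented. Qed.

(** A corner is glued to a zero-dimensional cell, and so is its image, which therefore has no
    interior coordinate. *)
Lemma image_corner O e : e \in P' -> image O e = 0 \/ image O e = l' e.
Proof.
move=> eP; have [h _] := phi_face (corner_box O _) (corner_box O _) (vertex_face O).
have := h e; rewrite /inner_coord vertex_set eP inE /= -/(image O).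
have /andP[] := phi_box (corner_box O (top tT)) eP; rewrite -/(image O).
rewrite !le_eqVlt => /orP[/eqP<-|i0]; first by left.
move=> /orP[/eqP->|i1]; first by right.
by rewrite i0 i1 /= => i2; rewrite i2 ltxx in i0.
Qed.

Lemma image_vertex O v : at_vert (sigma (vertex tT O)) v =
  face_div l' (sigma (top tT)) (image O) v.
Proof.
have [_ ->] := phi_face (corner_box O _) (corner_box O _) (vertex_face O).
by rewrite /face_div vertex_set big_set0 addr0.
Qed.

Definition set_or (O : edge G -> bool) e b f := if f == e then b else O f.

Lemma image_ext O O' : (forall e, e \notin T -> O e = O' e) ->
  forall e, e \in P' -> image O e = image O' e.
Proof.
(* At [t = 0] affinity says that the image depends only on the coordinates in [pd_set]. *)
move=> OO e eP; have := @phi_affine (top tT) 0 (corner O') (corner O') (corner O).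
move=> /(_ (corner_box _ _) (corner_box _ _) (corner_box _ _)); rewrite lexx ler01.
move=> /(_ isT); rewrite /image => -> //; first by rewrite subr0 mul1r mul0r addr0.
move=> f; rewrite top_in => fT; rewrite /corner OO // subr0 mul1r mul0r.
by rewrite addr0.
Qed.

Variables (e : edge G) (eT : e \notin T).

Lemma subset1 : [set e] \subset ~: T.
Proof. by rewrite sub1set inE. Qed.

Definition side O : QD v0 := oriented v0 O tT subset1.

Definition step O e' := image (set_or O e true) e' - image (set_or O e false) e'.

(* The opposite sides of a box are translates of each other. *)
Lemma step_indep O O' e' : e' \in P' -> step O e' = step O' e'.
Proof.
(* The corners [O] and [O'], each with both values at [e], form a parallelogram. [z] is the midpoint
   of both diagonals, and its image is computed in two ways. *)
move=> eP; pose z f := (corner (set_or O e true) f + corner (set_or O' e false) f) / 2.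
have zb : in_box l (top tT) z.
  move=> f _; rewrite /z /corner; have := l_gt0 f.
  by case: (set_or _ _ _ _); case: (set_or _ _ _ _) => ?; apply/andP; split; lra.
have half : 0 <= (1 / 2 : R) <= 1 by apply/andP; split; lra.
have h1 := phi_affine (corner_box (set_or O e true) _)
  (corner_box (set_or O' e false) _) zb half _ eP.
have h2 := phi_affine (corner_box (set_or O e false) _)
  (corner_box (set_or O' e true) _) zb half _ eP.
have {}h1 := h1 (fun f _ => ltac:(rewrite /z; lra)).
have {}h2 : phi (top tT) z e' = (1 - 1 / 2) * image (set_or O e false) e' +
    1 / 2 * image (set_or O' e true) e'.
  apply: h2 => f _; rewrite /z /corner /set_or; case: eqVneq => _; last by lra.
  by lra.
by rewrite /step; rewrite h2 in h1; move: h1; rewrite -!/(image _); lra.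
Qed.

(** It is computed from the side [q] alone and not from a box that [q] bounds, so it allows
    different boxes with a common side to be compared. *)
Definition quarter (q : QD v0) e' : R := inner_coord l' (sigma q) (phi q (fun=> l e / 4)) e'.

(* The side of a box in the direction e goes to a side in some direction e', and
   the point at a quarter of the former to the point at a quarter or at three
   quarters of the latter: its coordinate y tells in which sense e' is run through. *)
Definition decode (y : R) e' : R := if y == 0 then 0 else if y == l' e' / 4 then l' e' else - l' e'.

Lemma step_quarter O e' : e' \in P' -> step O e' = decode (quarter (side O) e') e'.
Proof.
move=> eP; pose x f := if f == e then l e / 4 else corner O f.
have xb : in_box l (top tT) x.
  move=> f fP; rewrite /x; case: eqVneq => [->|_]; last exact: corner_box fP.
  by have := l_gt0 e => ?; apply/andP; split; lra.
have yb : in_box l (side O) (fun=> l e / 4).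
  move=> f; rewrite oriented_in inE => /eqP->.
  by have := l_gt0 e => ?; apply/andP; split; lra.
have [|h _] := phi_face xb yb.
  apply: face_oriented => f; rewrite inE /x; last by move=> /eqP->; rewrite eqxx.
  by move=> _ /negPf->.
have q : 0 <= (1 / 4 : R) <= 1 by apply/andP; split; lra.
have z : phi (top tT) x e' = (1 - 1 / 4) * image (set_or O e false) e' +
    1 / 4 * image (set_or O e true) e'.
  apply: phi_affine (corner_box _ _) (corner_box _ _) xb q _ _ eP => f _.
  by rewrite /x /corner /set_or; case: eqVneq => [->|_]; lra.
rewrite /quarter -h /inner_coord eP z /step /decode; have p := l'_gt0 e'.
have [->|->] := image_corner (set_or O e false) eP;
  have [->|->] := image_corner (set_or O e true) eP; rewrite /=.
- by rewrite !mulr0 addr0 ltxx /= eqxx subrr.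
- rewrite mulr0 add0r (_ : 0 < _ < _); last by apply/andP; split; lra.
  by rewrite mul1r mulrC gt_eqF ?eqxx ?subr0 //; lra.
- rewrite mulr0 addr0 (_ : 0 < _ < _); last by apply/andP; split; lra.
  by rewrite !gt_eqF ?sub0r //; lra.
- by rewrite -mulrDl subrK mul1r ltxx andbF eqxx subrr.
Qed.

Lemma side_sub O : pd_set (sigma (side O)) \subset P'.
Proof.
have [phi' [sub _ _]] : pd_ge (sigma (top tT)) (sigma (side O)); last by [].
apply: sigma_mono.
have [b [sp _ _]] : face_of (top tT) (side O) (corner O) (corner O) by apply: face_oriented.
by exists (fun e => edge_end e (b e)).
Qed.

End Tree.

Definition decoded e (q : QD v0) e' : R := decode (quarter e q e') e'.

Lemma decoded0 e q e' : e' \notin pd_set (sigma q) -> decoded e q e' = 0.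
Proof. by move=> e'q; rewrite /decoded /quarter /inner_coord (negPf e'q) /decode eqxx. Qed.

Lemma decoded_indep (T : {set edge G}) (tT : tree T) e (eT : e \notin T) O O' e' :
  decoded e (side tT eT O) e' = decoded e (side tT eT O') e'.
Proof.
have [eP|eP] := boolP (e' \in pd_set (sigma (top tT))).
  by rewrite /decoded -!step_quarter // (step_indep _ _ O').
by rewrite !decoded0 //; apply: contra eP => /(subsetP (side_sub _ _ _)).
Qed.

(** The image of a side has dimension 1, so only one direction [a] moves; as distances are
    preserved, [a] has the length of [e]. *)
Lemma decoded_form (T : {set edge G}) (tT : tree T) e (eT : e \notin T) O :
  exists (a : edge G') (s : bool), l' a = l e /\
  forall e', decoded e (side tT eT O) e' =
    if e' == a then (if s then - l' a else l' a) else 0.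
Proof.
have /cards1P[a qa] : #|pd_set (sigma (side tT eT O))| == 1%N.
  by rewrite oriented_card cards1.
have aP : a \in pd_set (sigma (top tT)).
  by apply: (subsetP (side_sub tT eT O)); rewrite qa inE.
have off e' : e' != a -> decoded e (side tT eT O) e' = 0.
  by move=> ea; rewrite decoded0 // qa inE.
have dist : (decoded e (side tT eT O) a) ^+ 2 = l e ^+ 2.
  have := phi_dist (corner_box (set_or O e true) (top tT)) (corner_box (set_or O e false) (top tT)).
  rewrite (bigD1 a) //= big1 ?addr0 => [|e' /andP[eP ea]]; last first.
    rewrite -!/(image _ _) -/(step tT e O e') (step_quarter eT) // -/(decoded _ _ _) off //.
    by rewrite expr0n.
  rewrite -!/(image _ _) -/(step tT e O a) (step_quarter eT) // -/(decoded _ _ _) => ->.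
  rewrite (bigD1 e) ?top_in //= big1 ?addr0 => [|f /andP[_ fe]].
    by rewrite /corner /set_or eqxx subr0.
  by rewrite /corner /set_or (negPf fe) subrr expr0n.
have eqs (y : R) : 0 <= y -> y ^+ 2 = l e ^+ 2 -> y = l e.
  by move=> y0 /eqP; rewrite eqrXn2 ?(ltW (l_gt0 e)) // => /eqP.
exists a; move: dist; rewrite {1}/decoded /decode; case: ifP => [_|d0].
  by rewrite expr0n => /esym/eqP; rewrite sqrf_eq0 gt_eqF.
case: ifP => dq; rewrite ?sqrrN => /(eqs _ (ltW (l'_gt0 a))) la.
  exists false; split=> // e'; have [->|/off//] := eqVneq e' a.
  by rewrite /decoded /decode d0 dq.
exists true; split=> // e'; have [->|/off//] := eqVneq e' a.
by rewrite /decoded /decode d0 dq.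
Qed.

Lemma oriented_at_swap w0 (U S : {set edge G}) O f v : f \in U -> f \notin S ->
  oriented_at w0 (U :\ f) S O v =
  (edge_end f (O f) == v)%:Z +
  \sum_(h | (h \notin U) && (h \notin S)) (edge_end h (O h) == v)%:Z - (v == w0)%:Z.
Proof.
move=> fU fS; rewrite /oriented_at (bigD1 f) ?inE ?eqxx ?fS //=; congr (_ + _ - _).
apply: eq_bigl => h; rewrite !inE; have [->|] := eqVneq h f; first by rewrite fU andbF.
by rewrite andbT.
Qed.

Lemma edge_image e : exists (a : edge G') (s : bool), l' a = l e /\
  forall (T : {set edge G}) (tT : tree T), e \notin T ->
    a \in pd_set (sigma (top tT)) /\
    forall O e', e' \in pd_set (sigma (top tT)) ->
      step tT e O e' = if e' == a then (if s then - l' a else l' a) else 0.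
Proof.
have [T0 tT0 eT0] := tree_avoiding cG nbG e.
have [a [s [la H]]] := decoded_form tT0 eT0 xpred0; exists a, s; split=> // T tT eT.
pose Q T := forall (tT : tree T) (eT : e \notin T) O e', decoded e (side tT eT O) e' =
    if e' == a then (if s then - l' a else l' a) else 0.
have QT : Q T.
  apply: (tree_chain (e := e) (Q := Q) _ tT0 tT eT0 eT) => [U f g|]; last first.
    move=> tT' eT' O e'; rewrite (decoded_indep _ _ O xpred0) -H; congr (decoded e _ e').
    exact: val_inj.
  case/and4P=> /andP[fU tUf] /andP[gU tUg] fg /shareP[b [c bc]] eU Qf tUg' eUg O e'.
  (* With [f] and [g] oriented towards their common end, the sides of the boxes of [U :\ f] and
     [U :\ g] in the direction [e] are the same cell. *)
  pose O' h := if h == f then b else c.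
  rewrite (decoded_indep _ _ O O').
  have eUf : e \notin U :\ f by rewrite inE (negPf eU) andbF.
  rewrite -(Qf tUf eUf O' e'); congr (decoded e _ e').
  apply: val_inj; apply: pd_eq => // v; rewrite !oriented_vert.
  rewrite !oriented_at_swap // ?inE; try by apply: contraNneq eU => <-.
  by rewrite /O' eqxx [g == f]eq_sym (negPf fg) bc.
split=> [|O e' eP]; last by rewrite (step_quarter eT) // -/(decoded _ _ _) QT.
apply: contraT => aP; have := QT tT eT xpred0 a; rewrite eqxx decoded0; last first.
  by apply: contra aP => /(subsetP (side_sub _ _ _)).
by case: s {H Q QT} => /eqP; rewrite eq_sym ?oppr_eq0 gt_eqF.
Qed.

Lemma complex_edges : exists (eps : edge G -> edge G') (s : edge G -> bool),
  [/\ bijective eps, forall e, l' (eps e) = l e,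
      forall T : {set edge G}, tree (eps @: T) = tree T
    & forall U f g b c, exchangeable U f -> exchangeable U g -> f != g ->
      (edge_end (eps f) (b (+) s f) == edge_end (eps g) (c (+) s g)) =
      (edge_end f b == edge_end g c)].
Proof.
have /fin_all_exists[es esP] : forall e, exists d : edge G' * bool, l' d.1 = l e /\
    forall (T : {set edge G}) (tT : tree T), e \notin T ->
    d.1 \in pd_set (sigma (top tT)) /\
    forall O e', e' \in pd_set (sigma (top tT)) ->
      step tT e O e' = if e' == d.1 then (if d.2 then - l' d.1 else l' d.1) else 0.
  by move=> e; have [a [s H]] := edge_image e; exists (a, s).
pose eps e := (es e).1; pose s e := (es e).2; exists eps, s.
have epsP (T : {set edge G}) (tT : tree T) e : e \notin T -> eps e \in pd_set (sigma (top tT)).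
  by move=> eT; have [_ /(_ T tT eT)[]] := esP e.
have valE (T : {set edge G}) (tT : tree T) O e : e \notin T ->
    image tT O (eps e) = if O e (+) s e then l' (eps e) else 0.
  move=> eT; have [_ /(_ T tT eT)[eP /(_ O _ eP)]] := esP e; rewrite eqxx /step.
  have -> : image tT O (eps e) = image tT (set_or O e (O e)) (eps e).
    by apply: image_ext eP => f _; rewrite /set_or; case: eqVneq => // ->.
  rewrite -/(s e) -/(eps e); have p := l'_gt0 (eps e).
  have [e1|e1] := image_corner (set_or O e true) eP;
    have [e0|e0] := image_corner (set_or O e false) eP; rewrite e1 e0; move: e1 e0;
    case: (O e) (s e) => [] [] /= e1 e0 h; rewrite ?e1 ?e0; lra.
have injT (T : {set edge G}) (tT : tree T) e f : e \notin T -> f \notin T -> eps e = eps f -> e = f.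
  move=> eT fT ef; apply/eqP/negPn/negP => ne.
  (* This choice makes the common coordinate of the image 0 by the formula for [e], and positive by
     the formula for [f]. *)
  pose O h := if h == e then s e else ~~ s f.
  have := valE T tT O e eT; rewrite ef (valE T tT O f fT) /O eqxx addbb eq_sym (negPf ne).
  by rewrite addNb addbb /= => /eqP; rewrite gt_eqF.
have setE (T : {set edge G}) (tT : tree T) : pd_set (sigma (top tT)) = eps @: ~: T.
  apply/esym/eqP; rewrite eqEcard top_card card_in_imset ?leqnn ?andbT.
    apply/subsetP => _ /imsetP[e eT ->]; apply: (epsP T tT).
    by rewrite inE in eT.
  by move=> e f; rewrite !inE; apply: (injT T tT).
have surj a : exists e, eps e = a.
  have [T' tT' aT'] := tree_avoiding cG' nbG' a.
  have [T [tT]] := sigma_top_surj tT'; rewrite setE => /setP/(_ a).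
  by rewrite inE aT' => /imsetP[e _ ->]; exists e.
(* Distinct edges with the same image are avoided by no common tree, so they form a cut and can be
   exchanged in a tree. The two boxes then have the same directions in the image, hence the same
   image, against the injectivity of [sigma]. *)
have inj : injective eps.
  move=> e f ef; apply/eqP/negPn/negP => ne.
  have [v _] := graph_vert cG.
  have Nef : ~~ spanning (~: [set e; f]).
    apply/negP => /(tree_in v)[T Tef tT]; case/eqP: ne.
    by apply: (injT T tT) ef; apply/negP => /(subsetP Tef); rewrite !inE eqxx ?orbT.
  have [T tT eT] := tree_avoiding cG nbG e.
  have fT : f \in T.
    apply: contraR Nef => fT; apply: spanning_sub (tree_spanning tT).
    apply/subsetP => h hT; rewrite !inE; apply/norP; split.
      by apply: contraNneq eT => <-.
    by apply: contraNneq fT => <-.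
  pose U := e |: T.
  have UeT : U :\ e = T.
    by apply/setP => h; rewrite !inE; case: eqVneq => // ->; rewrite (negPf eT).
  have eUe : exchangeable U e by rewrite /exchangeable UeT tT !inE eqxx.
  have Tef : T :\ f \subset ~: [set e; f].
    apply/subsetP => h; rewrite !inE => /andP[hf hT]; apply/norP; split => //.
    by apply: contraNneq eT => <-.
  have swap h : h != f -> ~~ linked (T :\ f) (src h) (tgt h) ->
      linked (h |: (T :\ f)) (src f) (tgt f).
    move=> hf Nh; have hE b : linked (h |: (T :\ f)) (edge_end h b) (edge_end h (~~ b)).
      by apply: linked_ends; rewrite !inE eqxx.
    have sub := linked_sub (subsetUr [set h] (T :\ f)).
    have /orP[] := tree_split f false (src h) tT => fs;
      have /orP[] := tree_split f false (tgt h) tT => ft.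
    - by case/negP: Nh; apply: linked_trans ft; rewrite linkedC.
    - apply: linked_trans (sub _ _ fs) _; apply: linked_trans (hE false) _.
      by rewrite linkedC; apply: sub.
    - apply: linked_trans (sub _ _ ft) _; apply: linked_trans (hE true) _.
      by rewrite linkedC; apply: sub.
    - by case/negP: Nh; apply: linked_trans ft; rewrite linkedC.
  (* [G] without [f] is connected, and [e] is its only edge between the two sides of [T :\ f]:
     another one, [h], would complete [T :\ f] to a connected graph without [e] and [f]. *)
  have tTe : tree (U :\ f).
    have fU : f \in U by rewrite !inE fT orbT.
    have fe : f != e by rewrite eq_sym.
    suff lf : linked (U :\ f) (src f) (tgt f).
      by have /andP[] := exchangeable_swap eUe fU fe lf.
    have /spanningP/(_ (src f) (tgt f)) : spanning (~: [set f]).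
      by have := nbG f; rewrite /bridge negbK setTD.
    apply: linked_trans_ends => h; rewrite !inE => hf.
    have [he|he] := eqVneq h e.
      by apply: (@linked_ends _ _ _ false true); rewrite !inE he eqxx ne.
    have [lh|Nh] := boolP (linked (T :\ f) (src h) (tgt h)).
      by apply: linked_sub lh; apply: setSD; apply: subsetUr.
    case/negP: Nef; apply: (@spanning_edges _ T) (tree_spanning tT) => z zT.
    have sub : h |: (T :\ f) \subset ~: [set e; f].
      by rewrite subUset Tef sub1set !inE negb_or he hf.
    have [->|zf] := eqVneq z f; first exact: linked_sub sub (swap h hf Nh).
    apply: (@linked_ends _ _ _ false true); apply: (subsetP Tef).
    by rewrite !inE zf.
  have EqP : pd_set (sigma (top tT)) = pd_set (sigma (top tTe)).
    rewrite !setE; apply/setP => a; apply/imsetP/imsetP => -[h hT ->].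
      have [->|he] := eqVneq h e; first by exists f => //; rewrite !inE eqxx.
      exists h => //; move: hT; rewrite !inE (negPf he) /=.
      by move=> hT; rewrite negb_and hT orbT.
    have [->|hf] := eqVneq h f; first by exists e => //; rewrite inE.
    by exists h => //; move: hT; rewrite !inE hf /= negb_or => /andP[].
  have /sigma_inj/(congr1 (fun q : QD v0 => pd_set q)) : sigma (top tT) = sigma (top tTe).
    apply: val_inj; apply: pd_eq => // w.
    by rewrite (sigma_top tT).2 (sigma_top tTe).2.
  by move=> /setP/(_ e); rewrite !top_in eT !inE eqxx ne.
have epsB : bijective eps.
  have [inv invP] := fin_all_exists surj.
  by exists inv => // e; apply: inj; rewrite invP.
have imC (T : {set edge G}) : (eps @: (~: T) = ~: (eps @: T)).
  apply/setP => a; have [e <-] := surj a.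
  by rewrite inE !mem_imset // inE.
have vertE (T : {set edge G}) (tT : tree T) O v : at_vert (sigma (vertex tT O)) v =
    \sum_(e | e \notin T) (edge_end (eps e) (O e (+) s e) == v)%:Z - (v == v0')%:Z.
  rewrite image_vertex /face_div (sigma_top tT).2 addrC; congr (_ - _).
  rewrite setE big_imset /=; last by move=> ? ? _ _; apply: inj.
  apply: eq_big => [e|e]; rewrite inE // => eT; rewrite valE //; congr (_%:Z).
  have p := l'_gt0 (eps e); case: (O e (+) s e) => /=.
    by rewrite (gt_eqF p) eqxx.
  by rewrite eqxx (lt_eqF p) orbF.
split=> //; first by move=> e; case: (esP e).
  move=> T; apply/idP/idP => tT.
    have [T1 [tT1]] := sigma_top_surj tT; rewrite setE imC => /setC_inj/(imset_inj inj).
    by move=> <-.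
  by have [] := sigma_top tT; rewrite setE imC setCK.
move=> U f g b c /andP[fU tUf] /andP[gU tUg] fg.
(* The vertices that [O] gives in the boxes of [U :\ f] and [U :\ g] differ only by the chosen end
   of [f] or of [g], so they coincide iff these ends do. By [vertE] the same holds for their
   images. *)
pose O h := if h == f then b else c.
have Of : O f = b by rewrite /O eqxx.
have Og : O g = c by rewrite /O eq_sym (negPf fg).
have swap w h : h \in U -> tree (U :\ h) -> \sum_(e | e \notin U :\ h)
    (edge_end (eps e) (O e (+) s e) == w)%:Z =
    (edge_end (eps h) (O h (+) s h) == w)%:Z +
    \sum_(e | e \notin U) (edge_end (eps e) (O e (+) s e) == w)%:Z.
  move=> hU _; rewrite (bigD1 h) ?inE ?eqxx //=; congr (_ + _).
  apply: eq_bigl => e; rewrite !inE; case: eqVneq => [->|]; last by rewrite andbT.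
  by rewrite hU.
apply/eqP/eqP => E.
  have /sigma_inj/(congr1 (fun q : QD v0 => at_vert q (edge_end f b))) :
      sigma (vertex tUf O) = sigma (vertex tUg O).
    apply: val_inj; apply: pd_eq => [|w]; first by rewrite !vertex_set.
    by rewrite !vertE !swap // Of Og E.
  rewrite !oriented_vert !oriented_at_swap ?inE // Of Og eqxx -!addrA => /addIr.
  by case: eqVneq.
have VE : vertex tUf O = vertex tUg O.
  apply: val_inj; apply: pd_eq => // w.
  by rewrite !oriented_vert !oriented_at_swap ?inE // Of Og E.
have := congr1 (fun q : QD v0 => at_vert (sigma q) (edge_end (eps f) (b (+) s f))) VE.
rewrite !vertE !swap // Of Og eqxx -!addrA => /addIr.
by case: eqVneq.
Qed.

End Corners.

(** * Correspondence of blocks *)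

Section BlockCorrespondence.
Variables (G G' : mgraph).
Hypotheses (cG : graph_connected G) (cG' : graph_connected G').
Hypotheses (nbG : no_bridges G) (nbG' : no_bridges G').
Variables (eps : edge G -> edge G') (s : edge G -> bool).
Hypothesis eps_bij : bijective eps.
Hypothesis eps_tree : forall T : {set edge G}, tree (eps @: T) = tree T.
Hypothesis eps_end : forall U f g b c, exchangeable U f -> exchangeable U g -> f != g ->
  (edge_end (eps f) (b (+) s f) == edge_end (eps g) (c (+) s g)) =
  (edge_end f b == edge_end g c).

Let eps_inj : injective eps := bij_inj eps_bij.

Lemma eps_exchangeable (U : {set edge G}) f : exchangeable (eps @: U) (eps f) = exchangeable U f.
Proof.
rewrite /exchangeable mem_imset // -eps_tree; congr (_ && tree _).
apply/setP => a; rewrite !inE; apply/andP/imsetP => [[af /imsetP[e eU ea]]|[e]].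
  by exists e => //; rewrite !inE eU andbT; apply: contraNneq af => <-; rewrite ea.
by rewrite !inE => /andP[ef eU] ->; rewrite (inj_eq eps_inj) ef mem_imset.
Qed.

Lemma eps_neighbours (U : {set edge G}) f g :
  neighbours (eps @: U) (eps f) (eps g) = neighbours U f g.
Proof.
rewrite /neighbours !eps_exchangeable (inj_eq eps_inj).
have [Uf|] //= := boolP (exchangeable U f); have [Ug|] //= := boolP (exchangeable U g).
have [//|fg] /= := eqVneq f g; apply/shareP/shareP => -[b [c E]].
  exists (b (+) s f), (c (+) s g); apply/eqP.
  by rewrite -(eps_end _ _ Uf Ug fg) !addbK E.
by exists (b (+) s f), (c (+) s g); apply/eqP; rewrite (eps_end _ _ Uf Ug fg) E.
Qed.

Lemma eps_neighbouring f g : neighbouring (eps f) (eps g) = neighbouring f g.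
Proof.
apply/existsP/existsP => -[U Ufg]; last by exists (eps @: U); rewrite eps_neighbours.
exists (eps @^-1: U); rewrite -eps_neighbours (_ : eps @: _ = U) //.
apply/setP => a; have [inv invK epsK] := eps_bij; apply/imsetP/idP => [[e]|aU].
  by rewrite inE => eU ->.
by exists (inv a); rewrite ?inE epsK.
Qed.

Lemma eps_block e f : (eps f \in block (eps e)) = (f \in block e).
Proof.
have [inv invK epsK] := eps_bij; rewrite !inE; apply/idP/idP.
  case/connectP=> p pP lp; rewrite -[f]invK lp.
  elim: p e pP {lp} => [|y p IHp] x /=; first by rewrite invK.
  case/andP=> xy; rewrite -[y]epsK => /IHp; apply: connect_trans.
  by apply: connect1; rewrite -eps_neighbouring epsK.
case/connectP=> p pP ->; elim: p e pP => [|y p IHp] x //=.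
by case/andP=> xy /IHp; apply/connect_trans/connect1; rewrite eps_neighbouring.
Qed.

(** Without bridges every edge lies on a cycle, which has a second edge unless the edge is a loop.
    So loops are recognised from [neighbouring], which [eps] preserves. *)
Lemma loopE H (e : edge H) : graph_connected H -> no_bridges H ->
  (src e == tgt e) = ~~ [exists f, neighbouring e f].
Proof.
move=> cH nbH; apply/idP/idP => [le|].
  by apply/existsP => -[f /neighbouring_loopless]; rewrite le.
apply: contraR => ne; have [U Ue] := exchangeable_exists cH nbH e.
have [f ef] := exchangeable_neighbour Ue ne.
by apply/existsP; exists f; apply/existsP; exists U.
Qed.

Lemma block_share H (e f g : edge H) : graph_connected H -> no_bridges H ->
  f \in block e -> g \in block e -> f != g -> share f g -> neighbouring f g.
Proof.
by move=> cH nbH; apply: (biconnected_neighbouring cH (block_biconnected cH nbH e)).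
Qed.

(** For distinct [f] and [g], either equality makes two edges of a block share an end, hence
    neighbouring, in both graphs at once; then [eps_end] applies. For [f = g] the question is
    whether the edge is a loop. *)
Lemma eps_block_end e f g b c : f \in block e -> g \in block e ->
  (edge_end (eps f) (b (+) s f) == edge_end (eps g) (c (+) s g)) =
  (edge_end f b == edge_end g c).
Proof.
move=> fe ge; have [<-|fg] := eqVneq f g.
  have loop : (src (eps f) == tgt (eps f)) = (src f == tgt f).
    rewrite (loopE _ cG' nbG') (loopE _ cG nbG); congr (~~ _).
    have [inv invK epsK] := eps_bij.
    apply/existsP/existsP => -[z]; first by rewrite -[z]epsK eps_neighbouring; exists (inv z).
    by exists (eps z); rewrite eps_neighbouring.
  by move: loop; case: b c (s f) => [] [] [] //=; rewrite ?eqxx // ![tgt _ == _]eq_sym.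
have ends (H : mgraph) (h h' : edge H) d d' : edge_end h d = edge_end h' d' -> share h h'.
  by move=> E; apply/shareP; exists d, d'.
have fg_end : neighbouring f g -> (edge_end (eps f) (b (+) s f) ==
    edge_end (eps g) (c (+) s g)) = (edge_end f b == edge_end g c).
  by case/existsP=> U /and4P[Uf Ug _ _]; apply: eps_end Uf Ug fg.
apply/idP/idP => E; last by rewrite fg_end //;
  exact: (block_share cG nbG fe ge fg (ends _ _ _ _ _ (eqP E))).
rewrite -fg_end // -eps_neighbouring.
have fe' : eps f \in block (eps e) by rewrite eps_block.
have ge' : eps g \in block (eps e) by rewrite eps_block.
have fg' : eps f != eps g by rewrite (inj_eq eps_inj).
exact: (block_share cG' nbG' fe' ge' fg' (ends _ _ _ _ _ (eqP E))).
Qed.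

End BlockCorrespondence.

(** * Points of the complex *)

(** A coordinate frozen by the gluing is 0 or the length of its edge, and there [face_div] counts
    the very end to which the exceptional vertex is specialized. *)
Lemma face_invariant (R : realFieldType) (H : mgraph) (k : edge H -> R)
    (k_gt0 : forall e, 0 < k e) (p q : pseudo_divisor H) (x y : edge H -> R) :
  face_of k p q x y ->
  inner_coord k p x =1 inner_coord k q y /\ face_div k p x =1 face_div k q y.
Proof.
case=> b [[/subsetP qp _ atq] xy xb]; split=> [e|v].
  rewrite /inner_coord; have [eq|eq] := boolP (e \in pd_set q).
    by rewrite qp //= xy.
  have [ep|//] := boolP (e \in pd_set p); rewrite /= xb //.
  by case: (b e); rewrite ?ltxx ?andbF.
rewrite /face_div atq (bigID (mem (pd_set q))) /= -[RHS]addrA; congr (_ + _).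
rewrite addrC; congr (_ + _).
  rewrite -sum1_card -[RHS]natz natr_sum big_mkcond [RHS]big_mkcond.
  apply: eq_bigr => e _; rewrite !inE.
  have [eq|eq] := boolP (e \in pd_set q); rewrite ?andbF //=.
  have [ep|ep] := boolP (e \in pd_set p); rewrite //= xb //.
  have /gt_eqF ke := k_gt0 e.
  case: (b e); first by rewrite ke eqxx /=; case: eqP.
  by rewrite eqxx [0 == _]eq_sym ke orbF /=; case: eqP.
apply: eq_big => [e|e /andP[_ eq]]; last by rewrite xy.
by have [/qp ->|] := boolP (e \in pd_set q); rewrite ?andbF.
Qed.

Lemma sum_pd_edge (R : nmodType) (H : mgraph) (p : pseudo_divisor H) (F : edge H -> R) :
  \sum_(e in pd_set p) F e = \sum_(u : pd_edge p) F (val u).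
Proof. exact: big_sub. Qed.

From Stdlib Require Import Relations.
From mathcomp Require Import all_classical all_reals all_analysis.

Section Cells.
Variables (R : realType) (X : metric_graph R) (v0 : vert X).
Implicit Types (p q : QD v0) (x y : edge X -> R).

(** The default 0 makes [cell_at] total; points of the box are unchanged. *)
Definition clip p x (e : pd_edge p) : R :=
  if 0 <= x (val e) <= len (val e) then x (val e) else 0.

Arguments clip : clear implicits.

Lemma pd_edgeP p e : e \in pd_set p -> exists u : pd_edge p, val u = e.
Proof. by move=> ep; exists (Sub e ep); rewrite SubK. Qed.

Lemma clip_box p x : clip p x \in box p.
Proof.
apply/mem_set => e; rewrite /clip; case: ifP => // _.
by rewrite lexx ltW ?len_gt0.
Qed.

Definition cell_at p x : cell p := SigSub (clip_box p x).

Lemma cell_atE p x (e : pd_edge p) : in_box len p x -> cell_coord (cell_at p x) e = x (val e).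
Proof. by move=> xb; rewrite /cell_coord set_valE /= /clip (xb _ (valP e)). Qed.

Definition coords p (c : cell p) (e : edge X) : R :=
  if insub e is Some u then cell_coord c u else 0.

Lemma coordsE p (c : cell p) (e : pd_edge p) : coords c (val e) = cell_coord c e.
Proof. by rewrite /coords valK. Qed.

Lemma coords_box p (c : cell p) : in_box len p (coords c).
Proof.
move=> e /pd_edgeP[u <-]; rewrite coordsE /cell_coord set_valE; exact: (set_valP c u).
Qed.

Lemma glued_face p q (c : cell p) (d : cell q) :
  glued (cell_point c) (cell_point d) <-> face_of len p q (coords c) (coords d).
Proof.
split=> -[b [sp cd cb]]; exists b; split=> // e.
- move=> eq; have [qp _ _] := sp; have [u ue] := pd_edgeP (fintype.subsetP qp e eq).
  by have [w we] := pd_edgeP eq; rewrite -{1}ue -we !coordsE; apply: cd; rewrite ue we.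
- by move=> /pd_edgeP[u <-] eq; rewrite coordsE cb.
- by move=> f ef; rewrite -!coordsE ef cd // (valP f).
- by move=> eq; rewrite -coordsE cb // (valP e).
Qed.

Lemma cell_map_face p q (c : cell p) (d : cell q) :
  face_of len p q (coords c) (coords d) -> cell_map c = cell_map d.
Proof.
by move=> cd; apply/eqquotP/asboolP; apply: rst_step; apply/glued_face.
Qed.

Lemma cell_map_invariant p q (c : cell p) (d : cell q) : cell_map c = cell_map d ->
  inner_coord len p (coords c) =1 inner_coord len q (coords d) /\
  face_div len p (coords c) =1 face_div len q (coords d).
Proof.
move=> /eqquotP/asboolP.
pose I (a : cells v0) := (inner_coord len (tag a) (coords (tagged a)),
  face_div len (tag a) (coords (tagged a))).
suff E a b : clos_refl_sym_trans _ (@glued _ _ v0) a b ->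
    (I a).1 =1 (I b).1 /\ (I a).2 =1 (I b).2.
  exact: (E (cell_point c) (cell_point d)).
elim=> {a b} [[p1 c1] [p2 c2] /glued_face|a|a b _ [h1 h2]|a b d' _ [h1 h2] _ [h3 h4]].
- by move=> /face_invariant; apply; apply: len_gt0.
- by [].
- by split=> ?; rewrite ?h1 ?h2.
- by split=> ?; rewrite ?h1 ?h2.
Qed.

End Cells.

Section EdgesOfComplex.
Variables (R : realType) (X X' : metric_graph R) (v0 : vert X) (v0' : vert X').
Hypotheses (nbX : no_bridges X) (nbX' : no_bridges X').

Lemma Jqs_edges : Jqs_isomorphic v0 v0' ->
  exists (eps : edge X -> edge X') (s : edge X -> bool),
  [/\ bijective eps, forall e, len (eps e) = len e,
      forall T : {set edge X}, tree (eps @: T) = tree T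
    & forall U f g b c, exchangeable U f -> exchangeable U g -> f != g ->
      (edge_end (eps f) (b (+) s f) == edge_end (eps g) (c (+) s g)) =
      (edge_end f b == edge_end g c)].
Proof.
case=> F [F' [sigma [_ [tau sigmaK tauK] ge_iff fP]]].
pose f p : cell p -> cell (sigma p) := s2val (cid2 (fP p)).
have fI p : polytope_isometry (@f p) := s2valP (cid2 (fP p)).
have fF p (c : cell p) : F (cell_map c) = cell_map (f p c) := s2valP' (cid2 (fP p)) c.
pose phi p x := coords (f p (cell_at p x)).
apply: (@complex_edges R X X' v0 v0' len len (len_gt0 (m := X)) (len_gt0 (m := X'))
  (mg_connected X) (mg_connected X') nbX nbX' sigma tau phi sigmaK tauK).
- by move=> p q /ge_iff.
- by move=> p q; rewrite -{1}[p]tauK -{1}[q]tauK => /ge_iff.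
- by move=> p x _; apply: coords_box.
(* Points related by a face are one point of the complex, so [F] gives them one image, whose
   invariants can be read in either cell. *)
- move=> p q x y xb yb pq; apply: cell_map_invariant; rewrite -!fF.
  congr F; apply: cell_map_face.
  have [b [sp xy xb']] := pq; exists b; split=> // e.
    move=> eq; have [qp _ _] := sp; have [u ue] := pd_edgeP (fintype.subsetP qp e eq).
    have [w we] := pd_edgeP eq; rewrite -{1}ue -we !coordsE !cell_atE // ue we.
    exact: xy.
  by move=> /pd_edgeP[u <-] eq; rewrite coordsE cell_atE // xb' // (valP u).
- move=> p t x y z xb yb zb t01 zE e ep.
  have [_ /(_ t (cell_at p x) (cell_at p y) (cell_at p z) t01) aff _] := fI p.
  have [u <-] := pd_edgeP ep; rewrite /phi !coordsE; apply: aff => w.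
  by rewrite !cell_atE // zE // (valP w).
- move=> p x y xb yb; have [_ _ /(_ (cell_at p x) (cell_at p y)) dist] := fI p.
  transitivity (\sum_u (cell_coord (f p (cell_at p x)) u -
      cell_coord (f p (cell_at p y)) u) ^+ 2).
    by rewrite sum_pd_edge; apply: eq_bigr => u _; rewrite /phi !coordsE.
  by rewrite dist sum_pd_edge; apply: eq_bigr => u _; rewrite !cell_atE.
Qed.

End EdgesOfComplex.

(** * Isomorphisms of tropical curves *)

Section CurveMap.
Variables (R : realType) (Y Y' : metric_graph R).
Variables (nu : vert Y -> vert Y') (eta : edge Y -> edge Y') (s : edge Y -> bool).
Hypothesis eta_len : forall e, len (eta e) = len e.
Hypothesis eta_end : forall e b, edge_end (eta e) (b (+) s e) = nu (edge_end e b).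

Definition move_coord e (t : R) : R := if s e then len e - t else t.

Lemma move_coordP e t : 0 < t < len e -> 0 < move_coord e t < len (eta e).
Proof.
rewrite eta_len /move_coord; case: (s e) => // /andP[t0 t1].
by apply/andP; split; lra.
Qed.

Definition curve_map (x : curve Y) : curve Y' :=
  match x with
  | Vertex v => Vertex (nu v)
  | Inner e t h => Inner (move_coordP h)
  end.

Lemma curve_map_at e t x : at_coord e t x -> at_coord (eta e) (move_coord e t) (curve_map x).
Proof.
rewrite /move_coord; case: x => [v|f u h] /=; last first.
  by move=> [-> <-]; rewrite /move_coord; split.
have := eta_end e; case: (s e) => E /= [[-> ->]|[-> ->]].
- by right; rewrite subr0 eta_len; split=> //; rewrite -(E false).
- by left; rewrite subrr; split=> //; rewrite -(E true).
- by left; split=> //; rewrite -(E false).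
- by right; rewrite eta_len; split=> //; rewrite -(E true).
Qed.

Lemma curve_map_walk x y L : walk x y L -> walk (curve_map x) (curve_map y) L.
Proof.
elim=> {x y L} [x|x y z e t u L xt yu _ IH]; first exact: walk_nil.
suff -> : `|t - u| = `|move_coord e t - move_coord e u|.
  exact: walk_cons (curve_map_at xt) (curve_map_at yu) IH.
rewrite /move_coord; case: (s e) => //.
by rewrite distrC; congr (`|_|); lra.
Qed.

End CurveMap.

(** The map and its inverse send walks to walks of the same length, so the sets of lengths whose
    infima are the distances agree. *)
Lemma curve_iso_graph (R : realType) (Y Y' : metric_graph R)
    (nu : vert Y -> vert Y') (eta : edge Y -> edge Y') (s : edge Y -> bool) :
  bijective nu -> bijective eta -> (forall e, len (eta e) = len e) ->
  (forall e b, edge_end (eta e) (b (+) s e) = nu (edge_end e b)) ->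
  curve_isomorphic Y Y'.
Proof.
move=> [nu' nuK nuK'] [eta' etaK etaK'] el ee.
have el' e : len (eta' e) = len e by rewrite -el etaK'.
have ee' e b : edge_end (eta' e) (b (+) (s \o eta') e) = nu' (edge_end e b).
  apply: (can_inj nuK); rewrite nuK' -ee /= -addbA addbb addbF.
  by rewrite etaK'.
pose f := curve_map nu s el; pose g := curve_map nu' (s \o eta') el'.
have InnerE (Z : metric_graph R) (e e' : edge Z) t t' h h' : e = e' -> t = t' ->
    @Inner R Z e t h = @Inner R Z e' t' h'.
  by move=> ee1 tt; subst e' t'; congr Inner; apply: bool_irrelevance.
have fK : cancel f g.
  case=> [v|e t h] /=; first by rewrite nuK.
  by apply: InnerE => //; rewrite /move_coord /= etaK el; case: (s e) => //; lra.
have gK : cancel g f.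
  case=> [v|e t h] /=; first by rewrite nuK'.
  by apply: InnerE => //; rewrite /move_coord /= el'; case: (s (eta' e)) => //; lra.
exists f; split; first by exists g.
move=> x y; rewrite /curve_dist; congr inf; apply/seteqP; split=> L /=.
  by move=> /(curve_map_walk el' ee'); rewrite -!/(g _) !fK.
exact: (curve_map_walk el ee).
Qed.

(** A vertex is recovered as a class of half-edges with a common end, which is why each vertex must
    have an edge. *)
Lemma curve_iso_edges (R : realType) (Y Y' : metric_graph R)
    (eta : edge Y -> edge Y') (s : edge Y -> bool) :
  bijective eta -> (forall e, len (eta e) = len e) ->
  (forall v : vert Y, exists e, touches e v) -> (forall v : vert Y', exists e, touches e v) ->
  (forall e f b c, (edge_end (eta e) (b (+) s e) == edge_end (eta f) (c (+) s f)) =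
    (edge_end e b == edge_end f c)) ->
  curve_isomorphic Y Y'.
Proof.
move=> eB el vY vY' ee.
have /choice[d dE] : forall v : vert Y, exists d : edge Y * bool, edge_end d.1 d.2 = v.
  by move=> v; have [e /touchesP[b eb]] := vY v; exists (e, b).
pose nu v := edge_end (eta (d v).1) ((d v).2 (+) s (d v).1).
have nuE e b : edge_end (eta e) (b (+) s e) = nu (edge_end e b).
  by apply/eqP; rewrite ee dE.
apply: (@curve_iso_graph R Y Y' nu eta s) => //.
have nu_inj : injective nu.
  move=> v w; rewrite -[v in LHS]dE -[w in RHS]dE -!nuE => /eqP.
  by rewrite ee !dE => /eqP.
have nu_surj v' : exists v, nu v = v'.
  have [e' /touchesP[b <-]] := vY' v'; have [inv _ invK] := eB.
  exists (edge_end (inv e') (b (+) s (inv e'))).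
  by rewrite -nuE -addbA addbb addbF invK.
have [inv invK] := choice nu_surj; exists inv => // v.
by apply: nu_inj; rewrite invK.
Qed.

Lemma bicomponent_eq (G : mgraph) (C D : bicomponent G) : bc_sub C = bc_sub D -> C = D.
Proof.
case: C D => [S bS mS] [S' bS' mS'] /= SS; subst S'.
by rewrite (Prop_irrelevance bS bS') (Prop_irrelevance mS mS').
Qed.

(** * The bijection between the components *)

Section ComponentBijection.
Variables (R : realType) (X X' : metric_graph R).
Hypotheses (nbX : no_bridges X) (nbX' : no_bridges X').
Variables (eps : edge X -> edge X') (s : edge X -> bool).
Hypothesis eps_bij : bijective eps.
Hypothesis eps_len : forall e, len (eps e) = len e.
Hypothesis eps_block_in : forall e f, (eps f \in block (eps e)) = (f \in block e).
Hypothesis eps_ends : forall e f g b c, f \in block e -> g \in block e ->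
  (edge_end (eps f) (b (+) s f) == edge_end (eps g) (c (+) s g)) =
  (edge_end f b == edge_end g c).

Let cX := mg_connected X.
Let cX' := mg_connected X'.

Lemma component_touches (Z : metric_graph R) (C : bicomponent Z) e :
  no_bridges Z -> e \in sg_edge C ->
  forall v : vert (component_curve C), exists f, touches f v.
Proof.
move=> nbZ eC v.
have CV : sg_vert C = block_verts e by rewrite (bicomponent_block (mg_connected Z) nbZ eC).
have CE : sg_edge C = block e by rewrite (bicomponent_block (mg_connected Z) nbZ eC).
have : val v \in block_verts e by rewrite -CV; exact: valP.
rewrite finset.in_set => /exists_inP[f]; rewrite -CE.
by move=> fC fv; exists (Sub f fC); rewrite touches_graph_of SubK.
Qed.

Lemma component_iso (C : bicomponent X) (C' : bicomponent X') e :
  e \in sg_edge C -> eps e \in sg_edge C' ->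
  curve_isomorphic (component_curve C) (component_curve C').
Proof.
move=> eC eC'.
have CE : sg_edge C = block e by rewrite (bicomponent_block cX nbX eC).
have CE' : sg_edge C' = block (eps e) by rewrite (bicomponent_block cX' nbX' eC').
have epsC (f : edge (component_curve C)) : eps (val f) \in sg_edge C'.
  by rewrite CE' eps_block_in -CE (valP f).
pose eta (f : edge (component_curve C)) : edge (component_curve C') := Sub (eps (val f)) (epsC f).
apply: (@curve_iso_edges R _ _ eta (s \o val)).
- have [inv invK epsK] := eps_bij.
  have invC (f : edge (component_curve C')) : inv (val f) \in sg_edge C.
    by rewrite CE -eps_block_in epsK -CE' (valP f).
  exists (fun f => Sub (inv (val f)) (invC f)) => f; apply: val_inj; rewrite !SubK //.
- by move=> f; rewrite /= eps_len.
- exact: component_touches nbX eC.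
- exact: component_touches nbX' eC'.
- move=> f g b c.
  have endE (Z : metric_graph R) (D : bicomponent Z) (h : edge (component_curve D)) d :
      val (edge_end h d) = edge_end (val h) d by case: d.
  rewrite -!val_eqE !endE /= (@eps_ends e) // -CE; exact: valP.
Qed.

Lemma components_iso :
  exists beta : bicomponent X -> bicomponent X',
    bijective beta /\
    forall C, curve_isomorphic (component_curve C) (component_curve (beta C)).
Proof.
have [inv invK epsK] := eps_bij.
(* A component is named by any of its edges. A curve without edges is a point, which is its only
   component, and is treated apart. *)
have [E0|/card_gt0P[e0 _]] := posnP #|edge X|; last first.
  have E1 : (0 < #|edge X|)%N by apply/card_gt0P; exists e0.
  have E1' : (0 < #|edge X'|)%N by apply/card_gt0P; exists (eps e0).
  have /choice[pe peP] := fun C => bicomponent_edge cX nbX C E1.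
  have /choice[pe' peP'] := fun C => bicomponent_edge cX' nbX' C E1'.
  have blockC (e : edge X) (C : bicomponent X) : e \in sg_edge C ->
      C = block_component cX nbX e.
    by move=> eC; apply: bicomponent_eq; rewrite (bicomponent_block cX nbX eC).
  have blockC' (e : edge X') (C : bicomponent X') : e \in sg_edge C ->
      C = block_component cX' nbX' e.
    by move=> eC; apply: bicomponent_eq; rewrite (bicomponent_block cX' nbX' eC).
  exists (fun C => block_component cX' nbX' (eps (pe C))); split; last first.
    by move=> C; apply: (component_iso (peP C)); apply: block_id.
  exists (fun C => block_component cX nbX (inv (pe' C))) => C.
    apply/esym/blockC; have := peP' (block_component cX' nbX' (eps (pe C))).
    rewrite /= -(epsK (pe' _)) eps_block_in invK => h.
    by rewrite (bicomponent_block cX nbX (peP C)).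
  apply/esym/blockC'; have := peP (block_component cX nbX (inv (pe' C))).
  rewrite /= -eps_block_in epsK => h.
  by rewrite (bicomponent_block cX' nbX' (peP' C)).
have E0' : #|edge X'| = 0%N by rewrite -(bij_eq_card eps_bij).
have noX (e : edge X) : False by have := fintype0 e.
have noX' (e : edge X') : False by have := fintype0 e.
have single (Z : metric_graph R) (noZ : edge Z -> False) (u v : vert Z) : u = v.
  have /spanningP/(_ u v) := graph_spanning (mg_connected Z).
  move=> /(@linked_inv _ _ (pred1 u)) /=; rewrite eqxx => h.
  by apply/esym/eqP; rewrite -h // => e; case: (noZ e).
have compv (Z : metric_graph R) (noZ : edge Z -> False) (C D : bicomponent Z) : C = D.
  have sub (A B : bicomponent Z) : sg_le A B.
    have [/andP[/card_gt0P[w _] _] _] := bc_biconnected B.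
    apply/andP; split; apply/fintype.subsetP; last by move=> e; case: (noZ e).
    by move=> v _; rewrite (single Z noZ v (val w)); exact: valP.
  by apply: bicomponent_eq; apply: sg_le_anti.
have exC (Z : metric_graph R) (noZ : edge Z -> False) : exists C : bicomponent Z, True.
  have [v _] := graph_vert (mg_connected Z).
  have cl : [forall e in finset.set0, (src e \in finset.setTfor (vert Z)) &&
      (tgt e \in finset.setTfor (vert Z))].
    by apply/forallP => e; case: (noZ e).
  pose S := Subgraph cl.
  have vS : v \in sg_vert S by rewrite finset.inE.
  have bS : biconnected (graph_of S).
    apply: (@biconnected_point (graph_of S) (Sub v vS)) => [u|e].
      by apply: val_inj; apply: (single Z noZ).
    by case: (noZ (val e)).
  have mS T : biconnected (graph_of T) -> sg_le S T -> sg_le T S.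
    move=> _ _; apply/andP; split; apply/fintype.subsetP => x _; first by rewrite finset.inE.
    by case: (noZ x).
  by exists (Bicomponent bS mS).
have [C0 _] := exC X noX; have [C0' _] := exC X' noX'.
exists (fun=> C0'); split; first by exists (fun=> C0) => C; apply: compv.
move=> C; have [v vC] : exists v, v \in sg_vert C.
  by have [/andP[/card_gt0P[v _] _] _] := bc_biconnected C; exists (val v); exact: valP.
have [w wC] : exists w, w \in sg_vert C0'.
  by have [/andP[/card_gt0P[w _] _] _] := bc_biconnected C0'; exists (val w); exact: valP.
apply: (@curve_iso_graph R (component_curve C) (component_curve C0') (fun=> Sub w wC)
  (fun f => False_rect _ (noX (val f))) (fun=> false)) => [||e|e]; try by case: (noX (val e)).
  by exists (fun=> Sub v vC) => u; apply: val_inj; apply: single.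
by exists (fun f => False_rect _ (noX' (val f))) => f; [case: (noX (val f)) | case: (noX' (val f))].
Qed.

End ComponentBijection.

(* X and X' are tropical curves, given by arbitrary models; GX and GX' are their
   canonical models. The base vertices v0 and v0' are arbitrary. *)
Theorem theorem6p1 (R : realType) (X X' GX GX' : metric_graph R)
    (hX : canonical_model GX X) (hX' : canonical_model GX' X')
    (nbX : no_bridges GX) (nbX' : no_bridges GX')
    (v0 : vert GX) (v0' : vert GX') (hJ : Jqs_isomorphic v0 v0') :
  exists beta : bicomponent GX -> bicomponent GX',
    bijective beta /\
    forall C : bicomponent GX,
      curve_isomorphic (component_curve C) (component_curve (beta C)).
Proof.
have [eps [s [epsB epsL epsT epsE]]] := Jqs_edges nbX nbX' hJ.
have cX := mg_connected GX; have cX' := mg_connected GX'.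
apply: (components_iso nbX nbX' epsB epsL (s := s)) => [e f|e f g b c fe ge].
  exact: (eps_block epsB epsT epsE).
exact: (eps_block_end cX cX' nbX nbX' epsB epsT epsE _ _ fe ge).
Qed.
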